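(* The endofunctor $\exp(-\mathcal{F}(1))$ of the derived category $\mathbf{D}(\widetilde{NH}(1))$ of left $\widetilde{NH}(1)$-modules, given by derived tensor product over $\widetilde{NH}(1)$ with the two-term complex of bimodules $(\widetilde{NH}(1)\to\mathcal{F}(1))$, is not invertible.
   Context: $\widetilde{NH}$ is the associative (non-unital, idempotented) $\mathbb{Z}$-algebra with generators $1_n$ ($n\ge 0$), $\partial_{i,n}$ ($1\le i\le n-1$), $x_{i,n}$ ($1\le i\le n$), $v_{i,n}$ ($1\le i\le n$), and relations (for all admissible indices): (1) $1_n1_m=\delta_{n,m}1_n$, $1_n\partial_{i,n}=\partial_{i,n}1_n=\partial_{i,n}$, $1_nx_{i,n}=x_{i,n}1_n=x_{i,n}$, $1_{n-1}v_{i,n}=v_{i,n}1_n=v_{i,n}$; (2) $x_{i,n}x_{j,n}=x_{j,n}x_{i,n}$; $x_{i,n}\partial_{j,n}=\partial_{j,n}x_{i,n}$ if $i\ne j,j+1$; $\partial_{i,n}\partial_{j,n}=\partial_{j,n}\partial_{i,n}$ if $|i-j|>1$; $\partial_{i,n}^2=0$; $\partial_{i,n}\partial_{i+1,n}\partial_{i,n}=\partial_{i+1,n}\partial_{i,n}\partial_{i+1,n}$; $x_{i,n}\partial_{i,n}-\partial_{i,n}x_{i+1,n}=1_n$; $\partial_{i,n}x_{i,n}-x_{i+1,n}\partial_{i,n}=1_n$; (3) $v_{i,n}x_{j,n}=x_{j,n-1}v_{i,n}$ if $i>j$; $v_{i,n}x_{j,n}=x_{j-1,n-1}v_{i,n}$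 if $i<j$; $v_{i,n}\partial_{j,n}=\partial_{j,n-1}v_{i,n}$ if $i>j+1$; $v_{i,n}\partial_{j,n}=\partial_{j-1,n-1}v_{i,n}$ if $i<j$; $v_{i,n}v_{j,n+1}=v_{j,n}v_{i+1,n+1}$ if $i\ge j$; $v_{i,n}\partial_{i,n}=v_{i+1,n}\partial_{i,n}$. Put $v_n=v_{n,n}$. $\widetilde{NH}(1)$ is the quotient of $\widetilde{NH}$ by the two-sided ideal generated by all $x_{1,n}$, $n>0$. The idempotents $1_n$ with $n>1$ lie in this ideal, and $\widetilde{NH}(1)$ has $\mathbb{Z}$-basis $\{1_0,1_1,v_1\}$ with $v_1=1_0v_1=v_11_1$. The $\widetilde{NH}$-bimodule $\mathcal{F}$ is $\bigoplus_{m\ge 0,n\ge 1}1_m\widetilde{NH}1_n$ with action $a\cdot t\cdot b=a\,t\,(b\odot 1_1)$, where $b\odot 1_1$ denotes adding one vertical strand on the right of $b$ (so $1_n\odot 1_1=1_{n+1}$, $x_{i,n}\odot1_1=x_{i,n+1}$, $\partial_{i,n}\odot 1_1=\partial_{i,n+1}$, $v_{i,n}\odot 1_1=v_{i,n+1}$). $\mathcal{F}(1)$ is the corresponding quotient of $\mathcal F$ as an $\widetilde{NH}(1)$-bimodule: as a left module $\mathcal{F}(1)=\widetilde{NH}(1)1_1$, with $\mathbb{Z}$-basis $\{1_1,v_1\}$, and on the right $1_0$ acts as the identity while $1_1$ and $v_1$ act by zero. The complex has $\widetilde{NH}(1)$ in cohomological degree $0$ and $\mathcal{F}(1)$ in degree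 $1$, with differential the bimodule map $t\mapsto t v_1$ for $t\in\widetilde{NH}(1)1_0$ and $t\mapsto 0$ for $t\in\widetilde{NH}(1)1_1$. It is the reduction to $\widetilde{NH}(1)$ of the complex $\exp(-\mathcal{F})$. *)

(* Defs.v *)
From HB Require Import structures.
From mathcomp Require Import all_boot all_order all_algebra.
From mathcomp Require Import boolp.

Set Implicit Arguments.
Unset Strict Implicit.
Unset Printing Implicit Defensive.

Import GRing.Theory.
Local Open Scope ring_scope.
Local Open Scope quotient_scope.

(* [Idem n], [Dem i n], [Dot i n] and [Vee i n] stand for 1_n, d_{i,n}, x_{i,n}
   and v_{i,n}.  The indices are unrestricted here; [nh_rel] sets the generators
   with inadmissible indices to zero. *)
Inductive nh_gen : Type :=
  | Idem (n : nat)
  | Dem (i n : nat)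
  | Dot (i n : nat)
  | Vee (i n : nat).

Definition admissible (g : nh_gen) : bool :=
  match g with
  | Idem _ => true
  | Dem i n => (0 < i < n)%N
  | Dot i n => (0 < i <= n)%N
  | Vee i n => (0 < i <= n)%N
  end.

(* non-commutative, non-unital polynomial expressions in the generators *)
Inductive nh_term : Type :=
  | Gen of nh_gen
  | NZero
  | NOpp of nh_term
  | NAdd of nh_term & nh_term
  | NMul of nh_term & nh_term.

Declare Scope nh_scope.
Delimit Scope nh_scope with NH.
Bind Scope nh_scope with nh_term.
Notation "s ** t" := (NMul s t) (at level 40, left associativity) : nh_scope.
Notation "s - t" := (NAdd s (NOpp t)) : nh_scope.

Definition idem n := Gen (Idem n).
Definition dem i n := Gen (Dem i n).
Definition dot i n := Gen (Dot i n).
Definition vee i n := Gen (Vee i n).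

Local Open Scope nh_scope.

Inductive nh_rel : nh_term -> nh_term -> Prop :=
  | rel_inadmissible g : ~~ admissible g -> nh_rel (Gen g) NZero
  | rel_idem n : nh_rel (idem n ** idem n) (idem n)
  | rel_idem_orth n m : n <> m -> nh_rel (idem n ** idem m) NZero
  | rel_idem_dem i n : (0 < i < n)%N -> nh_rel (idem n ** dem i n) (dem i n)
  | rel_dem_idem i n : (0 < i < n)%N -> nh_rel (dem i n ** idem n) (dem i n)
  | rel_idem_dot i n : (0 < i <= n)%N -> nh_rel (idem n ** dot i n) (dot i n)
  | rel_dot_idem i n : (0 < i <= n)%N -> nh_rel (dot i n ** idem n) (dot i n)
  | rel_idem_vee i n : (0 < i <= n)%N ->
      nh_rel (idem n.-1 ** vee i n) (vee i n)
  | rel_vee_idem i n : (0 < i <= n)%N -> nh_rel (vee i n ** idem n) (vee i n)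
  | rel_dot_dot i j n : (0 < i <= n)%N -> (0 < j <= n)%N ->
      nh_rel (dot i n ** dot j n) (dot j n ** dot i n)
  | rel_dot_dem i j n : (0 < i <= n)%N -> (0 < j < n)%N ->
      i <> j -> i <> j.+1 ->
      nh_rel (dot i n ** dem j n) (dem j n ** dot i n)
  | rel_dem_dem i j n : (0 < i < n)%N -> (0 < j < n)%N ->
      (i.+1 < j)%N || (j.+1 < i)%N ->
      nh_rel (dem i n ** dem j n) (dem j n ** dem i n)
  | rel_dem_sq i n : (0 < i < n)%N -> nh_rel (dem i n ** dem i n) NZero
  | rel_braid i n : (0 < i)%N -> (i.+1 < n)%N ->
      nh_rel (dem i n ** dem i.+1 n ** dem i n)
             (dem i.+1 n ** dem i n ** dem i.+1 n)
  | rel_dot_dem_same i n : (0 < i < n)%N ->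
      nh_rel (dot i n ** dem i n - dem i n ** dot i.+1 n) (idem n)
  | rel_dem_dot_same i n : (0 < i < n)%N ->
      nh_rel (dem i n ** dot i n - dot i.+1 n ** dem i n) (idem n)
  | rel_vee_dot_lt i j n : (0 < i <= n)%N -> (0 < j <= n)%N -> (j < i)%N ->
      nh_rel (vee i n ** dot j n) (dot j n.-1 ** vee i n)
  | rel_vee_dot_gt i j n : (0 < i <= n)%N -> (0 < j <= n)%N -> (i < j)%N ->
      nh_rel (vee i n ** dot j n) (dot j.-1 n.-1 ** vee i n)
  | rel_vee_dem_lt i j n : (0 < i <= n)%N -> (0 < j < n)%N -> (j.+1 < i)%N ->
      nh_rel (vee i n ** dem j n) (dem j n.-1 ** vee i n)
  | rel_vee_dem_gt i j n : (0 < i <= n)%N -> (0 < j < n)%N -> (i < j)%N ->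
      nh_rel (vee i n ** dem j n) (dem j.-1 n.-1 ** vee i n)
  | rel_vee_vee i j n : (0 < j)%N -> (j <= i)%N -> (i <= n)%N ->
      nh_rel (vee i n ** vee j n.+1) (vee j n ** vee i.+1 n.+1)
  | rel_vee_dem i n : (0 < i < n)%N ->
      nh_rel (vee i n ** dem i n) (vee i.+1 n ** dem i n).

(* The relations of NH(1), the quotient of the algebra NH presented by [nh_rel]
   by the two-sided ideal generated by the [dot 1 n], n > 0. *)
Inductive nh1_rel : nh_term -> nh_term -> Prop :=
  | nh1_rel_nh s t : nh_rel s t -> nh1_rel s t
  | nh1_rel_dot1 n : (0 < n)%N -> nh1_rel (dot 1 n) NZero.

(* The congruence of non-unital rings generated by a relation. *)
Inductive nh_cong (R : nh_term -> nh_term -> Prop) :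
    nh_term -> nh_term -> Prop :=
  | cong_rel s t : R s t -> nh_cong R s t
  | cong_refl s : nh_cong R s s
  | cong_sym s t : nh_cong R s t -> nh_cong R t s
  | cong_trans s t u : nh_cong R s t -> nh_cong R t u -> nh_cong R s u
  | cong_opp s s' : nh_cong R s s' -> nh_cong R (NOpp s) (NOpp s')
  | cong_add s s' t t' : nh_cong R s s' -> nh_cong R t t' ->
      nh_cong R (NAdd s t) (NAdd s' t')
  | cong_mul s s' t t' : nh_cong R s s' -> nh_cong R t t' ->
      nh_cong R (s ** t) (s' ** t')
  | cong_addA s t u : nh_cong R (NAdd s (NAdd t u)) (NAdd (NAdd s t) u)
  | cong_addC s t : nh_cong R (NAdd s t) (NAdd t s)
  | cong_add0 s : nh_cong R (NAdd NZero s) s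
  | cong_addN s : nh_cong R (NAdd (NOpp s) s) NZero
  | cong_mulA s t u : nh_cong R (s ** (t ** u)) (s ** t ** u)
  | cong_mulDl s t u :
      nh_cong R (NAdd s t ** u) (NAdd (s ** u) (t ** u))
  | cong_mulDr s t u :
      nh_cong R (s ** NAdd t u) (NAdd (s ** t) (s ** u)).

Local Close Scope nh_scope.

HB.instance Definition _ := gen_eqMixin nh_term.
HB.instance Definition _ := gen_choiceMixin nh_term.

Definition nh1_eqb (s t : nh_term) : bool := `[< nh_cong nh1_rel s t >].

Lemma nh1_eqb_refl : reflexive nh1_eqb.
Proof. by move=> s; apply/asboolP; apply: cong_refl. Qed.

Lemma nh1_eqb_sym : symmetric nh1_eqb.
Proof. by move=> s t; apply/asboolP/asboolP; apply: cong_sym. Qed.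

Lemma nh1_eqb_trans : transitive nh1_eqb.
Proof.
by move=> t s u /asboolP st /asboolP tu; apply/asboolP/(cong_trans st tu).
Qed.

Canonical nh1_equiv := EquivRel nh1_eqb nh1_eqb_refl nh1_eqb_sym nh1_eqb_trans.

Definition NH1 : Type := {eq_quot nh1_equiv}.
HB.instance Definition _ := Choice.on NH1.
HB.instance Definition _ := Quotient.on NH1.

Definition nh1 (t : nh_term) : NH1 := \pi_NH1 t.

Lemma nh1_eqP s t : nh1 s = nh1 t <-> nh_cong nh1_rel s t.
Proof.
by split=> [st|st]; [apply/asboolP/(eqmodP nh1_equiv)
                    | apply/(eqmodP nh1_equiv)/asboolP].
Qed.

Lemma nh1_ind (P : NH1 -> Prop) : (forall t, P (nh1 t)) -> forall a, P a.
Proof. by move=> Pnh1 a; rewrite -[a]reprK; apply: Pnh1. Qed.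

Lemma nh1_repr (t : nh_term) : nh_cong nh1_rel (repr (nh1 t)) t.
Proof. by apply/nh1_eqP; rewrite /nh1 reprK. Qed.

Definition nh1_opp (a : NH1) : NH1 := nh1 (NOpp (repr a)).
Definition nh1_add (a b : NH1) : NH1 := nh1 (NAdd (repr a) (repr b)).
Definition nh1_mul (a b : NH1) : NH1 := nh1 (NMul (repr a) (repr b)).
(* NH(1) is unital because [idem n] vanishes in it for n > 1.  The modules over
   it as an idempotented algebra are the unital ones, i.e. [lmodType NH1]. *)
Definition nh1_one : NH1 := nh1 (NAdd (idem 0) (idem 1)).

Lemma nh1_oppE s : nh1_opp (nh1 s) = nh1 (NOpp s).
Proof. by apply/nh1_eqP/cong_opp/nh1_repr. Qed.

Lemma nh1_addE s t : nh1_add (nh1 s) (nh1 t) = nh1 (NAdd s t).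
Proof. by apply/nh1_eqP/cong_add; apply: nh1_repr. Qed.

Lemma nh1_mulE s t : nh1_mul (nh1 s) (nh1 t) = nh1 (NMul s t).
Proof. by apply/nh1_eqP/cong_mul; apply: nh1_repr. Qed.

Lemma nh1_addrA : associative nh1_add.
Proof.
elim/nh1_ind=> s; elim/nh1_ind=> t; elim/nh1_ind=> u.
by rewrite !nh1_addE; apply/nh1_eqP/cong_addA.
Qed.

Lemma nh1_addrC : commutative nh1_add.
Proof.
elim/nh1_ind=> s; elim/nh1_ind=> t.
by rewrite !nh1_addE; apply/nh1_eqP/cong_addC.
Qed.

Lemma nh1_add0r : left_id (nh1 NZero) nh1_add.
Proof. by elim/nh1_ind=> s; rewrite nh1_addE; apply/nh1_eqP/cong_add0. Qed.

Lemma nh1_addNr : left_inverse (nh1 NZero) nh1_opp nh1_add.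
Proof.
by elim/nh1_ind=> s; rewrite nh1_oppE nh1_addE; apply/nh1_eqP/cong_addN.
Qed.

HB.instance Definition _ :=
  GRing.isZmodule.Build NH1 nh1_addrA nh1_addrC nh1_add0r nh1_addNr.

Lemma nh1_0 : nh1 NZero = 0. Proof. by []. Qed.
Lemma nh1_N s : nh1 (NOpp s) = - nh1 s. Proof. by rewrite -nh1_oppE. Qed.
Lemma nh1_D s t : nh1 (NAdd s t) = nh1 s + nh1 t.
Proof. by rewrite -nh1_addE. Qed.

Lemma nh1_mulrA : associative nh1_mul.
Proof.
elim/nh1_ind=> s; elim/nh1_ind=> t; elim/nh1_ind=> u.
by rewrite !nh1_mulE; apply/nh1_eqP/cong_mulA.
Qed.

Lemma nh1_mulrDl : left_distributive nh1_mul +%R.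
Proof.
elim/nh1_ind=> s; elim/nh1_ind=> t; elim/nh1_ind=> u.
by rewrite -nh1_D !nh1_mulE -nh1_D; apply/nh1_eqP/cong_mulDl.
Qed.

Lemma nh1_mulrDr : right_distributive nh1_mul +%R.
Proof.
elim/nh1_ind=> s; elim/nh1_ind=> t; elim/nh1_ind=> u.
by rewrite -nh1_D !nh1_mulE -nh1_D; apply/nh1_eqP/cong_mulDr.
Qed.

Lemma nh1_mul0r a : nh1_mul 0 a = 0.
Proof.
by apply: (addrI (nh1_mul 0 a)); rewrite -nh1_mulrDl !addr0.
Qed.

Lemma nh1_mulr0 a : nh1_mul a 0 = 0.
Proof.
by apply: (addrI (nh1_mul a 0)); rewrite -nh1_mulrDr !addr0.
Qed.

Lemma nh1_mulNr a b : nh1_mul (- a) b = - nh1_mul a b.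
Proof.
by apply: (addrI (nh1_mul a b)); rewrite -nh1_mulrDl !subrr nh1_mul0r.
Qed.

Lemma nh1_mulrN a b : nh1_mul a (- b) = - nh1_mul a b.
Proof.
by apply: (addrI (nh1_mul a b)); rewrite -nh1_mulrDr !subrr nh1_mulr0.
Qed.

Lemma nh1_relE s t : nh_rel s t -> nh1 s = nh1 t.
Proof. by move=> st; apply/nh1_eqP/cong_rel/nh1_rel_nh. Qed.

Lemma nh1_dot1 n : (0 < n)%N -> nh1 (dot 1 n) = 0.
Proof. by move=> n0; apply/nh1_eqP/cong_rel/nh1_rel_dot1. Qed.

Lemma nh1_idem0 n : (1 < n)%N -> nh1 (idem n) = 0.
Proof.
move=> n1; have i1 : (0 < 1 < n)%N by [].
have d1 : nh1_mul (nh1 (dem 1 n)) (nh1 (dot 2 n)) = - nh1 (idem n).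
  have := nh1_relE (rel_dot_dem_same i1).
  rewrite nh1_D nh1_N -!nh1_mulE nh1_dot1 1?ltnW // nh1_mul0r add0r => <-.
  by rewrite opprK.
have d0 : nh1 (dem 1 n) = 0.
  apply: oppr_inj; rewrite oppr0 -(nh1_relE (rel_dem_idem i1)) -nh1_mulE.
  rewrite -nh1_mulrN -d1 nh1_mulrA nh1_mulE (nh1_relE (rel_dem_sq i1)).
  exact: nh1_mul0r.
by apply: oppr_inj; rewrite -d1 d0 nh1_mul0r oppr0.
Qed.

Definition gen_src (g : nh_gen) : nat :=
  match g with Idem n => n | Dem _ n => n | Dot _ n => n | Vee _ n => n end.

Definition gen_tgt (g : nh_gen) : nat :=
  match g with Idem n => n | Dem _ n => n | Dot _ n => n | Vee _ n => n.-1 end.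

Lemma gen_idem g : nh1_mul (nh1 (Gen g)) (nh1 (idem (gen_src g))) = nh1 (Gen g).
Proof.
have [ag|ag] := boolP (admissible g); last first.
  by rewrite (nh1_relE (rel_inadmissible ag)) nh1_mul0r.
rewrite nh1_mulE; apply: nh1_relE; case: g ag => [n _|i n|i n|i n] //=.
- exact: rel_idem.
- exact: rel_dem_idem.
- exact: rel_dot_idem.
- exact: rel_vee_idem.
Qed.

Lemma idem_gen g : nh1_mul (nh1 (idem (gen_tgt g))) (nh1 (Gen g)) = nh1 (Gen g).
Proof.
have [ag|ag] := boolP (admissible g); last first.
  by rewrite (nh1_relE (rel_inadmissible ag)) nh1_mulr0.
rewrite nh1_mulE; apply: nh1_relE; case: g ag => [n _|i n|i n|i n] //=.
- exact: rel_idem.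
- exact: rel_idem_dem.
- exact: rel_idem_dot.
- exact: rel_idem_vee.
Qed.

Lemma idem_idem n m :
  nh1_mul (nh1 (idem n)) (nh1 (idem m)) = if n == m then nh1 (idem n) else 0.
Proof.
rewrite nh1_mulE; case: eqP => [<-|nm]; apply: nh1_relE.
  exact: rel_idem.
exact: rel_idem_orth.
Qed.

Lemma one_idem n : nh1_mul nh1_one (nh1 (idem n)) = nh1 (idem n).
Proof.
rewrite /nh1_one nh1_D nh1_mulrDl !idem_idem.
case: n => [|[|n]] /=; rewrite ?addr0 ?add0r //.
by rewrite nh1_idem0.
Qed.

Lemma idem_one n : nh1_mul (nh1 (idem n)) nh1_one = nh1 (idem n).
Proof.
rewrite /nh1_one nh1_D nh1_mulrDr !idem_idem.
case: n => [|[|n]] /=; rewrite ?addr0 ?add0r //.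
by rewrite nh1_idem0.
Qed.

Lemma nh1_mul1r : left_id nh1_one nh1_mul.
Proof.
elim/nh1_ind; elim=> [g||s IHs|s IHs t IHt|s IHs t IHt].
- by rewrite -idem_gen nh1_mulrA one_idem.
- by rewrite nh1_0 nh1_mulr0.
- by rewrite nh1_N nh1_mulrN IHs.
- by rewrite nh1_D nh1_mulrDr IHs IHt.
- by rewrite -nh1_mulE nh1_mulrA IHs.
Qed.

Lemma nh1_mulr1 : right_id nh1_one nh1_mul.
Proof.
elim/nh1_ind; elim=> [g||s IHs|s IHs t IHt|s IHs t IHt].
- by rewrite -gen_idem -nh1_mulrA idem_one.
- by rewrite nh1_0 nh1_mul0r.
- by rewrite nh1_N nh1_mulNr IHs.
- by rewrite nh1_D nh1_mulrDl IHs IHt.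
- by rewrite -nh1_mulE -nh1_mulrA IHt.
Qed.

HB.instance Definition _ :=
  GRing.Zmodule_isPzRing.Build NH1
    nh1_mulrA nh1_mul1r nh1_mulr1 nh1_mulrDl nh1_mulrDr.

Lemma nh1_M s t : nh1 (NMul s t) = nh1 s * nh1 t.
Proof. by rewrite -nh1_mulE. Qed.

Definition one0 : NH1 := nh1 (idem 0).
Definition one1 : NH1 := nh1 (idem 1).
Definition v1 : NH1 := nh1 (vee 1 1).

Lemma v1_idem1 : v1 * one1 = v1.
Proof. by rewrite -nh1_M; apply/nh1_relE/rel_vee_idem. Qed.

Lemma idem0_v1 : one0 * v1 = v1.
Proof. by rewrite -nh1_M; apply/nh1_relE/(@rel_idem_vee 1 1). Qed.

Lemma nh1_1E : 1 = one0 + one1 :> NH1.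
Proof. by rewrite -nh1_D. Qed.

Lemma nh1_src_gt1 g : (1 < gen_src g)%N -> nh1 (Gen g) = 0.
Proof.
by move=> g1; rewrite -gen_idem nh1_idem0 // nh1_mulr0.
Qed.

(* Adding a vertical strand on the right.  The inadmissible generators are
   zero, and their shifts could be admissible (e.g. [Vee 1 0]). *)
Definition shift_gen (g : nh_gen) : nh_gen :=
  match g with
  | Idem n => Idem n.+1
  | Dem i n => Dem i n.+1
  | Dot i n => Dot i n.+1
  | Vee i n => Vee i n.+1
  end.

Fixpoint shift_term (t : nh_term) : nh_term :=
  match t with
  | Gen g => if admissible g then Gen (shift_gen g) else NZero
  | NZero => NZero
  | NOpp s => NOpp (shift_term s)
  | NAdd s t => NAdd (shift_term s) (shift_term t)
  | NMul s t => NMul (shift_term s) (shift_term t)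
  end.

Definition nh1_shift_term (t : nh_term) : NH1 := nh1 (shift_term t).

Lemma nh1_shift_gen g :
  nh1_shift_term (Gen g) = if g is Idem 0 then one1 else 0.
Proof.
rewrite /nh1_shift_term /=; case: ifP => [|/negbT ag].
  by case: g => [[|n]|i [|n]|i [|n]|i [|n]] //=;
    rewrite ?ltn0 ?andbF ?leqn0 ?lt0n ?andNb // => _; apply: nh1_src_gt1.
by case: g ag => [[|n]||i n|i n].
Qed.

Lemma nh1_shift_term0 : nh1_shift_term NZero = 0. Proof. by []. Qed.

Lemma nh1_shift_termN s : nh1_shift_term (NOpp s) = - nh1_shift_term s.
Proof. exact: nh1_N. Qed.

Lemma nh1_shift_termD s t :
  nh1_shift_term (NAdd s t) = nh1_shift_term s + nh1_shift_term t.
Proof. exact: nh1_D. Qed.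

Lemma nh1_shift_termM s t :
  nh1_shift_term (NMul s t) = nh1_shift_term s * nh1_shift_term t.
Proof. exact: nh1_M. Qed.

Lemma nh1_shift_rel s t : nh_rel s t -> nh1_shift_term s = nh1_shift_term t.
Proof.
have E := (nh1_shift_termM, nh1_shift_termD, nh1_shift_termN,
           nh1_shift_term0, nh1_shift_gen, mul0r, mulr0, subrr).
have one11 : one1 * one1 = one1 by rewrite -nh1_M; apply/nh1_relE/rel_idem.
case=> {s t}.
- move=> g ag; rewrite nh1_shift_term0 /nh1_shift_term /=.
  by rewrite (negbTE ag).
- by move=> [|n]; rewrite !E.
- by move=> [|n] [|m] nm; rewrite !E.
all: try by move=> *; rewrite !E.
all: by move=> [|i] [|n] // _; rewrite !E.
Qed.

Lemma nh1_shift_cong s t :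
  nh_cong nh1_rel s t -> nh1_shift_term s = nh1_shift_term t.
Proof.
elim=> {s t} //=.
- move=> _ _ [s t|n n0]; first exact: nh1_shift_rel.
  by rewrite nh1_shift_gen.
- by move=> s t u _ -> _.
- by move=> s s' _ E; rewrite !nh1_shift_termN E.
- by move=> s s' t t' _ Es _ Et; rewrite !nh1_shift_termD Es Et.
- by move=> s s' t t' _ Es _ Et; rewrite !nh1_shift_termM Es Et.
- by move=> s t u; rewrite !nh1_shift_termD addrA.
- by move=> s t; rewrite !nh1_shift_termD addrC.
- by move=> s; rewrite nh1_shift_termD add0r.
- by move=> s; rewrite nh1_shift_termD nh1_shift_termN addNr.
- by move=> s t u; rewrite !nh1_shift_termM mulrA.
- by move=> s t u; rewrite !(nh1_shift_termM, nh1_shift_termD) mulrDl.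
- by move=> s t u; rewrite !(nh1_shift_termM, nh1_shift_termD) mulrDr.
Qed.

(* the map induced on NH(1) by adding a vertical strand on the right *)
Definition nh1_shift (a : NH1) : NH1 := nh1_shift_term (repr a).

Lemma nh1_shiftE t : nh1_shift (nh1 t) = nh1 (shift_term t).
Proof. exact/nh1_shift_cong/nh1_repr. Qed.

Lemma nh1_shiftD : {morph nh1_shift : a b / a + b}.
Proof.
by elim/nh1_ind=> s; elim/nh1_ind=> t; rewrite -nh1_D !nh1_shiftE nh1_D.
Qed.

Lemma nh1_shiftN : {morph nh1_shift : a / - a}.
Proof. by elim/nh1_ind=> s; rewrite -nh1_N !nh1_shiftE nh1_N. Qed.

Lemma nh1_shiftM : {morph nh1_shift : a b / a * b}.
Proof.
by elim/nh1_ind=> s; elim/nh1_ind=> t; rewrite -nh1_M !nh1_shiftE nh1_M.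
Qed.

Lemma nh1_shift1 : nh1_shift 1 = one1.
Proof.
by rewrite nh1_1E nh1_shiftD !nh1_shiftE -!/(nh1_shift_term _) !nh1_shift_gen addr0.
Qed.

(* Bimodules over a ring, the left action being the one of [lmodType]. *)
Record bimodule (A : pzRingType) := Bimodule {
  bm_sort :> lmodType A;
  ract : bm_sort -> A -> bm_sort;
  ractDl : forall a, {morph ract^~ a : x y / x + y};
  ractDr : forall x, {morph ract x : a b / a + b};
  ractM : forall x a b, ract x (a * b) = ract (ract x a) b;
  ract1 : forall x, ract x 1 = x;
  ractZ : forall a x b, ract (a *: x) b = a *: ract x b
}.

Record bimod_hom (A : pzRingType) (X Y : bimodule A) := BimodHom {
  bm_map :> {linear X -> Y};
  bm_map_ract : forall x a, bm_map (ract x a) = ract (bm_map x) a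
}.

Definition regular_bimodule (A : pzRingType) : bimodule A :=
  @Bimodule A A^o (fun x a => x * a) (fun a x y => mulrDl x y a)
    (fun x a b => mulrDr x a b) (fun x a b => mulrA x a b) (@mulr1 A)
    (fun a x b => esym (mulrA a x b)).

(* X (x)_A M : the abelian group generated by the symbols [TPure x m] modulo
   biadditivity and the exchange relations. *)
Inductive tens_term (X M : Type) : Type :=
  | TPure of X & M
  | TZero
  | TOpp of tens_term X M
  | TAdd of tens_term X M & tens_term X M.

Arguments TZero {X M}.

Inductive tens_cong (A : pzRingType) (X : bimodule A) (M : lmodType A) :
    tens_term X M -> tens_term X M -> Prop :=
  | tens_pureDl x y m : tens_cong (TPure (x + y) m)
      (TAdd (TPure x m) (TPure y m))
  | tens_pureDr x m n : tens_cong (TPure x (m + n))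
      (TAdd (TPure x m) (TPure x n))
  | tens_exchange x a m : tens_cong (TPure (ract x a) m) (TPure x (a *: m))
  | tens_refl s : tens_cong s s
  | tens_sym s t : tens_cong s t -> tens_cong t s
  | tens_trans s t u : tens_cong s t -> tens_cong t u -> tens_cong s u
  | tens_opp s s' : tens_cong s s' -> tens_cong (TOpp s) (TOpp s')
  | tens_add s s' t t' : tens_cong s s' -> tens_cong t t' ->
      tens_cong (TAdd s t) (TAdd s' t')
  | tens_addA s t u : tens_cong (TAdd s (TAdd t u)) (TAdd (TAdd s t) u)
  | tens_addC s t : tens_cong (TAdd s t) (TAdd t s)
  | tens_add0 s : tens_cong (TAdd TZero s) s
  | tens_addN s : tens_cong (TAdd (TOpp s) s) TZero.

HB.instance Definition _ (X M : Type) := gen_eqMixin (tens_term X M).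
HB.instance Definition _ (X M : Type) := gen_choiceMixin (tens_term X M).

Section Tensor.
Variables (A : pzRingType) (X : bimodule A) (M : lmodType A).

Definition tens_eqb (s t : tens_term X M) : bool := `[< tens_cong s t >].

Lemma tens_eqb_refl : reflexive tens_eqb.
Proof. by move=> s; apply/asboolP; apply: tens_refl. Qed.

Lemma tens_eqb_sym : symmetric tens_eqb.
Proof. by move=> s t; apply/asboolP/asboolP; apply: tens_sym. Qed.

Lemma tens_eqb_trans : transitive tens_eqb.
Proof.
by move=> t s u /asboolP st /asboolP tu; apply/asboolP/(tens_trans st tu).
Qed.

Canonical tens_equiv :=
  EquivRel tens_eqb tens_eqb_refl tens_eqb_sym tens_eqb_trans.

Definition tensor : Type := {eq_quot tens_equiv}.
HB.instance Definition _ := Choice.on tensor.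
HB.instance Definition _ := Quotient.on tensor.

Definition tens (t : tens_term X M) : tensor := \pi_tensor t.

Lemma tens_eqP s t : tens s = tens t <-> tens_cong s t.
Proof.
by split=> [st|st]; [apply/asboolP/(eqmodP tens_equiv)
                    | apply/(eqmodP tens_equiv)/asboolP].
Qed.

Lemma tens_ind (P : tensor -> Prop) : (forall t, P (tens t)) -> forall a, P a.
Proof. by move=> Ptens a; rewrite -[a]reprK; apply: Ptens. Qed.

Lemma tens_repr (t : tens_term X M) : tens_cong (repr (tens t)) t.
Proof. by apply/tens_eqP; rewrite /tens reprK. Qed.

Definition tensor_opp (a : tensor) : tensor := tens (TOpp (repr a)).
Definition tensor_add (a b : tensor) : tensor := tens (TAdd (repr a) (repr b)).

Lemma tensor_oppE s : tensor_opp (tens s) = tens (TOpp s).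
Proof. by apply/tens_eqP/tens_opp/tens_repr. Qed.

Lemma tensor_addE s t : tensor_add (tens s) (tens t) = tens (TAdd s t).
Proof. by apply/tens_eqP/tens_add; apply: tens_repr. Qed.

Lemma tensor_addrA : associative tensor_add.
Proof.
elim/tens_ind=> s; elim/tens_ind=> t; elim/tens_ind=> u.
by rewrite !tensor_addE; apply/tens_eqP/tens_addA.
Qed.

Lemma tensor_addrC : commutative tensor_add.
Proof.
elim/tens_ind=> s; elim/tens_ind=> t.
by rewrite !tensor_addE; apply/tens_eqP/tens_addC.
Qed.

Lemma tensor_add0r : left_id (tens TZero) tensor_add.
Proof. by elim/tens_ind=> s; rewrite tensor_addE; apply/tens_eqP/tens_add0. Qed.

Lemma tensor_addNr : left_inverse (tens TZero) tensor_opp tensor_add.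
Proof.
by elim/tens_ind=> s; rewrite tensor_oppE tensor_addE; apply/tens_eqP/tens_addN.
Qed.

HB.instance Definition _ :=
  GRing.isZmodule.Build tensor tensor_addrA tensor_addrC tensor_add0r tensor_addNr.

Definition tpure (x : X) (m : M) : tensor := tens (TPure x m).

Lemma tens0 : tens TZero = 0. Proof. by []. Qed.
Lemma tensN s : tens (TOpp s) = - tens s. Proof. by rewrite -tensor_oppE. Qed.
Lemma tensD s t : tens (TAdd s t) = tens s + tens t.
Proof. by rewrite -tensor_addE. Qed.

Lemma tpureDl x y m : tpure (x + y) m = tpure x m + tpure y m.
Proof. by rewrite -tensD; apply/tens_eqP/tens_pureDl. Qed.

Lemma tpureDr x m n : tpure x (m + n) = tpure x m + tpure x n.
Proof. by rewrite -tensD; apply/tens_eqP/tens_pureDr. Qed.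

Lemma tpure_ract x a m : tpure (ract x a) m = tpure x (a *: m).
Proof. by apply/tens_eqP/tens_exchange. Qed.

Section Lift.
Variables (V : zmodType) (f : X -> M -> V).

Fixpoint tlift_term (t : tens_term X M) : V :=
  match t with
  | TPure x m => f x m
  | TZero => 0
  | TOpp s => - tlift_term s
  | TAdd s t => tlift_term s + tlift_term t
  end.

Definition tlift (a : tensor) : V := tlift_term (repr a).

Hypothesis fDl : forall m, {morph f^~ m : x y / x + y}.
Hypothesis fDr : forall x, {morph f x : m n / m + n}.
Hypothesis f_ract : forall x a m, f (ract x a) m = f x (a *: m).

Lemma tlift_cong s t : tens_cong s t -> tlift_term s = tlift_term t.
Proof.
elim=> {s t} //=.
- by move=> x y m; apply: fDl.
- by move=> s t u _ -> _.
- by move=> s s' _ ->.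
- by move=> s s' t t' _ -> _ ->.
- by move=> s t u; rewrite addrA.
- by move=> s t; rewrite addrC.
- by move=> s; rewrite add0r.
- by move=> s; rewrite addNr.
Qed.

Lemma tliftE t : tlift (tens t) = tlift_term t.
Proof. exact/tlift_cong/tens_repr. Qed.

Lemma tlift_pure x m : tlift (tpure x m) = f x m.
Proof. exact: tliftE. Qed.

Lemma tliftD : {morph tlift : a b / a + b}.
Proof.
by elim/tens_ind=> s; elim/tens_ind=> t; rewrite -tensD !tliftE.
Qed.
End Lift.

Lemma tensor_ind (P : tensor -> Prop) :
  (forall x m, P (tpure x m)) -> (forall a, P a -> P (- a)) ->
  (forall a b, P a -> P b -> P (a + b)) -> P 0 -> forall a, P a.
Proof.
move=> Ppure PN PD P0; elim/tens_ind; elim=> [x m||s Ps|s Ps t Pt].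
- exact: Ppure.
- exact: P0.
- by rewrite tensN; apply: PN.
- by rewrite tensD; apply: PD.
Qed.

Lemma tensor_morph_ext (V : zmodType) (f g : tensor -> V) :
  {morph f : a b / a + b} -> {morph g : a b / a + b} ->
  (forall x m, f (tpure x m) = g (tpure x m)) -> f =1 g.
Proof.
have morph0 (h : tensor -> V) : {morph h : a b / a + b} -> h 0 = 0.
  by move=> hD; apply: (addrI (h 0)); rewrite -hD !addr0.
move=> fD gD fg; elim/tensor_ind=> // [a Ea|a b Ea Eb|].
- apply: (addrI (f a)); rewrite -fD Ea -gD !subrr.
  by rewrite !morph0.
- by rewrite fD gD Ea Eb.
- by rewrite !morph0.
Qed.

Definition tensor_scale (a : A) : tensor -> tensor :=
  tlift (fun x m => tpure (a *: x) m).

Lemma tensor_scaleP a :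
  [/\ forall m, {morph (fun x => tpure (a *: x) m) : x y / x + y},
      forall x, {morph tpure (a *: x) : m n / m + n} &
      forall x b m, tpure (a *: ract x b) m = tpure (a *: x) (b *: m)].
Proof.
split=> [m x y|x m n|x b m].
- by rewrite scalerDr tpureDl.
- exact: tpureDr.
- by rewrite -ractZ tpure_ract.
Qed.

Lemma tensor_scale_pure a x m : tensor_scale a (tpure x m) = tpure (a *: x) m.
Proof. by have [Dl Dr E] := tensor_scaleP a; apply: tlift_pure. Qed.

Lemma tensor_scaleDr : right_distributive tensor_scale +%R.
Proof. by move=> a; have [Dl Dr E] := tensor_scaleP a; apply: tliftD. Qed.

Lemma tensor_scaleA a b t :
  tensor_scale a (tensor_scale b t) = tensor_scale (a * b) t.
Proof.
move: t; apply: tensor_morph_ext => [s t|s t|x m]; rewrite ?tensor_scaleDr //.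
by rewrite !tensor_scale_pure scalerA.
Qed.

Lemma tensor_scale1 : left_id 1 tensor_scale.
Proof.
apply: tensor_morph_ext => [s t|s t|x m]; rewrite ?tensor_scaleDr //.
by rewrite tensor_scale_pure scale1r.
Qed.

Lemma tensor_scaleDl t : {morph tensor_scale^~ t : a b / a + b}.
Proof.
move=> a b; move: t; apply: tensor_morph_ext => [s t|s t|x m].
- by rewrite tensor_scaleDr.
- by rewrite !tensor_scaleDr addrACA.
- by rewrite !tensor_scale_pure scalerDl tpureDl.
Qed.

HB.instance Definition _ := GRing.Zmodule_isLmodule.Build A tensor
  tensor_scaleA tensor_scale1 tensor_scaleDr tensor_scaleDl.

Lemma tpureZ a x m : a *: tpure x m = tpure (a *: x) m.
Proof. exact: tensor_scale_pure. Qed.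
End Tensor.

Section TensorMap.
Variables (A : pzRingType) (X Y : bimodule A) (M N : lmodType A).
Variables (f : bimod_hom X Y) (g : {linear M -> N}).

Definition tmap : tensor X M -> tensor Y N :=
  tlift (fun x m => tpure (f x) (g m)).

Lemma tmapP :
  [/\ forall m, {morph (fun x => tpure (f x) (g m)) : x y / x + y},
      forall x, {morph (fun m => tpure (f x) (g m)) : m n / m + n} &
      forall x a m, tpure (f (ract x a)) (g m) = tpure (f x) (g (a *: m))].
Proof.
split=> [m x y|x m n|x a m].
- by rewrite linearD tpureDl.
- by rewrite linearD tpureDr.
- by rewrite linearZ bm_map_ract tpure_ract.
Qed.

Lemma tmap_pure x m : tmap (tpure x m) = tpure (f x) (g m).
Proof. by have [Dl Dr E] := tmapP; apply: tlift_pure. Qed.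

Lemma tmapD : {morph tmap : s t / s + t}.
Proof. by have [Dl Dr E] := tmapP; apply: tliftD. Qed.

Lemma tmap_linear : linear tmap.
Proof.
move=> a s t; rewrite tmapD; congr (_ + _); move: s.
apply: tensor_morph_ext => [s s'|s s'|x m]; rewrite ?scalerDr ?tmapD //.
- by rewrite scalerDr.
- by rewrite tpureZ !tmap_pure linearZ tpureZ.
Qed.

HB.instance Definition _ :=
  GRing.isLinear.Build A (tensor X M) (tensor Y N) *:%R tmap tmap_linear.
End TensorMap.

(* F(1) = NH(1) 1_1 as a left module; this is the sum of the NH(1) 1_n, n > 0,
   since 1_n vanishes in NH(1) for n > 1. *)
Record F1_type := F1Val { f1_val :> NH1^o; _ : f1_val * one1 == f1_val }.
HB.instance Definition _ := [isSub for f1_val].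
HB.instance Definition _ := [Choice of F1_type by <:].

Lemma F1_closed : subsemimod_closed (fun a : NH1^o => a * one1 == a).
Proof.
split; first split.
- by rewrite -topredE /= mul0r.
- move=> a b; rewrite -!topredE /= => /eqP Ea /eqP Eb.
  by rewrite mulrDl Ea Eb.
- move=> c a; rewrite -!topredE /= => /eqP Ea.
  by rewrite -[c *: a]/(c * a) -mulrA Ea.
Qed.

HB.instance Definition _ := GRing.SubChoice_isSubLmodule.Build
  NH1 NH1^o (fun a : NH1^o => a * one1 == a) F1_type F1_closed.

Lemma f1_valP (t : F1_type) : f1_val t * one1 = f1_val t.
Proof. by case: t => t /= /eqP. Qed.

Lemma F1_ract_subproof (t : F1_type) (b : NH1) :
  (f1_val t * nh1_shift b : NH1^o) * one1 == f1_val t * nh1_shift b.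
Proof. by rewrite -mulrA -nh1_shift1 -nh1_shiftM mulr1. Qed.

(* t . b = t (b (.) 1_1) *)
Definition F1_ract (t : F1_type) (b : NH1) : F1_type :=
  F1Val (F1_ract_subproof t b).

Lemma F1_ractDl b : {morph F1_ract^~ b : s t / s + t}.
Proof. by move=> s t; apply: val_inj; rewrite /= mulrDl. Qed.

Lemma F1_ractDr t : {morph F1_ract t : a b / a + b}.
Proof. by move=> a b; apply: val_inj; rewrite /= nh1_shiftD mulrDr. Qed.

Lemma F1_ractM t a b : F1_ract t (a * b) = F1_ract (F1_ract t a) b.
Proof. by apply: val_inj; rewrite /= nh1_shiftM mulrA. Qed.

Lemma F1_ract1 t : F1_ract t 1 = t.
Proof. by apply: val_inj; rewrite /= nh1_shift1 f1_valP. Qed.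

Lemma F1_ractZ a t b : F1_ract (a *: t) b = a *: F1_ract t b.
Proof. by apply: val_inj; rewrite /= -mulrA. Qed.

Definition F1 : bimodule NH1 :=
  @Bimodule NH1 F1_type F1_ract F1_ractDl F1_ractDr F1_ractM F1_ract1 F1_ractZ.

(* The right action is the one of the description of F(1) by a basis. *)
Lemma F1_ract_one0 (t : F1) : ract t one0 = t.
Proof. by apply: val_inj; rewrite /= nh1_shiftE f1_valP. Qed.

Lemma F1_ract_one1 (t : F1) : ract t one1 = 0.
Proof.
by apply: val_inj; rewrite /= nh1_shiftE -/(nh1_shift_term _) nh1_shift_gen mulr0.
Qed.

Lemma F1_ract_v1 (t : F1) : ract t v1 = 0.
Proof.
by apply: val_inj; rewrite /= nh1_shiftE -/(nh1_shift_term _) nh1_shift_gen mulr0.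
Qed.

Lemma one1_v1 : one1 * v1 = 0.
Proof.
have e10 : one1 * one0 = 0.
  by rewrite -nh1_M -nh1_0; apply/nh1_relE/rel_idem_orth.
by rewrite -idem0_v1 mulrA e10 mul0r.
Qed.

(* [v1] commutes with the right actions on NH(1) and F(1). *)
Lemma v1_shift (b : NH1) : b * v1 = v1 * nh1_shift b.
Proof.
elim/nh1_ind: b; elim=> [g||s IHs|s IHs t IHt|s IHs t IHt].
- rewrite nh1_shiftE -/(nh1_shift_term _) nh1_shift_gen.
  have Eg : nh1 (Gen g) * nh1 (idem (gen_src g)) = nh1 (Gen g) := gen_idem g.
  have g0 : (0 < gen_src g)%N -> nh1 (Gen g) * v1 = 0.
    case: (gen_src g) Eg => [|[|n]] // Eg _.
      by rewrite -Eg -mulrA [X in _ * X]one1_v1 mulr0.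
    by rewrite -Eg nh1_idem0 // mulr0 mul0r.
  have g0' : ~~ admissible g -> nh1 (Gen g) * v1 = 0.
    by move=> ag; rewrite (nh1_relE (rel_inadmissible ag)) nh1_0 mul0r.
  case: g {Eg} g0 g0' => [[|n]|i [|n]|i [|n]|i [|n]] g0 g0' /=;
    rewrite ?mulr0; try exact: g0.
  + by rewrite [LHS]idem0_v1 v1_idem1.
  + by apply: g0'; rewrite /= ltn0 andbF.
  + by apply: g0'; rewrite /= leqn0 lt0n andNb.
  + by apply: g0'; rewrite /= leqn0 lt0n andNb.
- by rewrite nh1_0 mul0r -nh1_0 nh1_shiftE mulr0.
- by rewrite nh1_N mulNr IHs nh1_shiftN mulrN.
- by rewrite nh1_D mulrDl nh1_shiftD mulrDr IHs IHt.
- by rewrite nh1_M -mulrA IHt mulrA IHs -mulrA nh1_shiftM.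
Qed.

Lemma mul_v1_subproof (t : NH1) : (t * v1 : NH1^o) * one1 == t * v1.
Proof. by rewrite -mulrA v1_idem1. Qed.

(* t |-> t v_1, which vanishes on NH(1) 1_1 by [one1_v1] *)
Definition mul_v1 (t : regular_bimodule NH1) : F1 := F1Val (mul_v1_subproof t).

Lemma mul_v1_linear : linear mul_v1.
Proof.
by move=> a s t; apply: val_inj; rewrite /= mulrDl -[a *: s]/(a * s) -mulrA.
Qed.

HB.instance Definition _ := GRing.isLinear.Build NH1
  (regular_bimodule NH1) F1 *:%R mul_v1 mul_v1_linear.

Lemma mul_v1_ract (t : regular_bimodule NH1) (b : NH1) :
  mul_v1 (ract t b) = ract (mul_v1 t) b.
Proof. by apply: val_inj; rewrite /= -!mulrA v1_shift. Qed.

(* Cohomological complexes, with a differential between all pairs of degrees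
   which vanishes outside (i, i + 1): this avoids transports along equalities
   between degrees. *)
Record complex (A : pzRingType) := Complex {
  cx_obj :> int -> lmodType A;
  cx_d : forall i j, {linear cx_obj i -> cx_obj j};
  cx_d_shape : forall i j x, j != i + 1 -> cx_d i j x = 0;
  cx_dd : forall i j k x, cx_d j k (cx_d i j x) = 0
}.

Record chain_map (A : pzRingType) (M N : complex A) := ChainMap {
  cm_map :> forall i, {linear M i -> N i};
  cm_comm : forall i j x, cm_map j (cx_d M i j x) = cx_d N i j (cm_map i x)
}.

Section Complexes.
Variable A : pzRingType.
Implicit Types M N P : complex A.

Definition cm_eq M N (f g : chain_map M N) : Prop := forall i x, f i x = g i x.

Definition cocycle M i (x : M i) : Prop := cx_d M i (i + 1) x = 0.

Definition coboundary M i (x : M i) : Prop :=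
  exists y : M (i - 1), cx_d M (i - 1) i y = x.

(* The two conjuncts are injectivity and surjectivity of H^i(f). *)
Definition quasi_iso M N (f : chain_map M N) : Prop :=
  forall i,
    (forall x : M i, cocycle x -> coboundary (f i x) -> coboundary x) /\
    (forall y : N i, cocycle y ->
       exists2 x : M i, cocycle x & coboundary (y - f i x)).

Definition acyclic M : Prop := forall i (x : M i), cocycle x -> coboundary x.

Definition null_homotopic M N (f : chain_map M N) : Prop :=
  exists h : forall i j, {linear M i -> N j}, forall i (x : M i),
    f i x = cx_d N (i - 1) i (h i (i - 1) x)
            + h (i + 1) i (cx_d M i (i + 1) x).

Definition K_projective P : Prop :=
  forall N, acyclic N -> forall f : chain_map P N, null_homotopic f.

Definition cm_id M : chain_map M M :=
  @ChainMap A M M (fun i => idfun) (fun i j x => erefl).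

Lemma cm_comp_comm M N P (g : chain_map N P) (f : chain_map M N) i j x :
  (g j \o f j) (cx_d M i j x) = cx_d P i j ((g i \o f i) x).
Proof. by rewrite /= !cm_comm. Qed.

Definition cm_comp M N P (g : chain_map N P) (f : chain_map M N) :
    chain_map M P :=
  @ChainMap A M P (fun i => (g i \o f i : {linear _ -> _})) (cm_comp_comm g f).
End Complexes.

Record two_term (A : pzRingType) := TwoTerm {
  tt0 : bimodule A;
  tt1 : bimodule A;
  tt_d : bimod_hom tt0 tt1
}.

(* The identity between components with equal indices, and zero otherwise. *)
Section Transport.
Variables (A : pzRingType) (M : int -> lmodType A).

Definition same_deg (i j : int) : M i -> M j :=
  match i =P j with
  | ReflectT e => fun x => ecast k (M k) e x
  | ReflectF _ => fun=> 0
  end.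

Lemma same_deg_linear i j : linear (@same_deg i j).
Proof.
rewrite /same_deg; case: eqP => [e|_] a x y; first by case: j / e.
by rewrite scaler0 addr0.
Qed.

HB.instance Definition _ i j :=
  GRing.isLinear.Build A (M i) (M j) *:%R (@same_deg i j) (@same_deg_linear i j).

Lemma same_deg_id i x : @same_deg i i x = x.
Proof. by rewrite /same_deg; case: eqP => // e; rewrite eq_axiomK. Qed.

Lemma same_deg_neq i j x : i != j -> @same_deg i j x = 0.
Proof. by rewrite /same_deg; case: eqP. Qed.
End Transport.

Arguments same_deg {A} M i j _.

Definition bimod_id (A : pzRingType) (X : bimodule A) : bimod_hom X X :=
  @BimodHom A X X idfun (fun x a => erefl).

Section TensorComplex.
Variables (A : pzRingType) (X : two_term A) (M : complex A).

(* (X (x) M)^n = X^0 (x) M^n (+) X^1 (x) M^(n-1) *)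
Definition tcx_obj (n : int) : lmodType A :=
  (tensor (tt0 X) (M n) * tensor (tt1 X) (M (n - 1)))%type.

(* d (x0 (x) m, x1 (x) m') = (x0 (x) d m, d x0 (x) m - x1 (x) d m') *)
Definition tcx_d (i j : int) (u : tcx_obj i) : tcx_obj j :=
  (tmap (bimod_id (tt0 X)) (cx_d M i j) u.1,
   tmap (tt_d X) (same_deg M i (j - 1)) u.1
   - tmap (bimod_id (tt1 X)) (cx_d M (i - 1) (j - 1)) u.2).

Lemma tcx_d_linear i j : linear (@tcx_d i j).
Proof.
move=> a u v; apply: injective_projections; rewrite /tcx_d /= !linearP //.
by rewrite /= scalerDr addrACA.
Qed.

HB.instance Definition _ i j := GRing.isLinear.Build A
  (tcx_obj i) (tcx_obj j) *:%R (@tcx_d i j) (@tcx_d_linear i j).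

Lemma tcx_d_shape i j (u : tcx_obj i) : j != i + 1 -> tcx_d j u = 0.
Proof.
move=> ij; have ij' : j - 1 != i by rewrite subr_eq.
have ij'' : j - 1 != i - 1 + 1 by rewrite subrK.
have tmap0 (Y Z : bimodule A) (f : bimod_hom Y Z) (N N' : lmodType A)
    (g : {linear N -> N'}) (t : tensor Y N) :
    (forall x, g x = 0) -> tmap f g t = 0.
  move=> g0; have tpure0 x : tpure x 0 = 0 :> tensor Z N'.
    by apply: (addrI (tpure x 0)); rewrite -tpureDr !addr0.
  elim/tensor_ind: t => [x m|t Et|t t' Et Et'|].
  - by rewrite tmap_pure g0.
  - by rewrite linearN /= Et oppr0.
  - by rewrite linearD /= Et Et' addr0.
  - by rewrite linear0.
rewrite /tcx_d !tmap0 ?subrr // => x.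
- exact: cx_d_shape.
- by rewrite /= same_deg_neq // eq_sym.
- exact: cx_d_shape.
Qed.

Lemma same_deg_d i j k l x : k + 1 = j ->
  same_deg M j l (cx_d M i j x) = cx_d M k l (same_deg M i k x).
Proof.
move=> kj; have [E|jl] := eqVneq j l.
  rewrite -{}E same_deg_id; have [E|ik] := eqVneq i k.
    by rewrite -{}E same_deg_id.
  rewrite [in RHS]same_deg_neq // linear0 cx_d_shape // -kj.
  by rewrite (inj_eq (addIr 1)) eq_sym.
by rewrite same_deg_neq // cx_d_shape // kj eq_sym.
Qed.

Lemma tmap_comp (Y Y' Y'' : bimodule A) (f : bimod_hom Y Y')
    (f' : bimod_hom Y' Y'') (f'' : bimod_hom Y Y'') (N N' N'' : lmodType A)
    (g : {linear N -> N'}) (g' : {linear N' -> N''}) (g'' : {linear N -> N''}) :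
  (forall x, f' (f x) = f'' x) -> (forall x, g' (g x) = g'' x) ->
  forall t, tmap f' g' (tmap f g t) = tmap f'' g'' t.
Proof.
move=> Ef Eg; apply: tensor_morph_ext => [s t|s t|x m]; rewrite ?tmapD //.
by rewrite !tmap_pure Ef Eg.
Qed.

Lemma tcx_dd i j k (u : tcx_obj i) : tcx_d k (tcx_d j u) = 0.
Proof.
have dd i' j' k' (Y : bimodule A) (t : tensor Y (M i')) :
    tmap (bimod_id Y) (cx_d M j' k') (tmap (bimod_id Y) (cx_d M i' j') t) = 0.
  move: t; apply: tensor_morph_ext => [s t|s t|x m]; rewrite ?tmapD ?addr0 //.
  rewrite !tmap_pure cx_dd.
  by apply: (addrI (tpure x 0)); rewrite -tpureDr !addr0.
apply: injective_projections; rewrite /tcx_d /= ?dd // linearB /= dd subr0.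
apply/eqP; rewrite subr_eq0; apply/eqP.
pose h : {linear M i -> M (k - 1)} := (same_deg M j (k - 1) \o cx_d M i j).
rewrite (@tmap_comp _ _ _ _ _ (tt_d X) _ _ _ _ _ h) //.
rewrite (@tmap_comp _ _ _ _ _ (tt_d X) _ _ _ _ _ h) // => x.
by rewrite /h /= (@same_deg_d _ _ (j - 1)) ?subrK.
Qed.

Definition tensor_complex : complex A :=
  @Complex A tcx_obj (fun i j => @tcx_d i j) tcx_d_shape tcx_dd.
End TensorComplex.

Section TensorComplexMap.
Variables (A : pzRingType) (X : two_term A) (M N : complex A).
Variable f : chain_map M N.

Definition tcx_map i (u : tcx_obj X M i) : tcx_obj X N i :=
  (tmap (bimod_id (tt0 X)) (f i) u.1, tmap (bimod_id (tt1 X)) (f (i - 1)) u.2).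

Lemma tcx_map_linear i : linear (@tcx_map i).
Proof.
by move=> a u v; apply: injective_projections; rewrite /tcx_map /= !linearP.
Qed.

HB.instance Definition _ i := GRing.isLinear.Build A
  (tcx_obj X M i) (tcx_obj X N i) *:%R (@tcx_map i) (@tcx_map_linear i).

Lemma same_deg_map i j x : f j (same_deg M i j x) = same_deg N i j (f i x).
Proof.
have [<-|ij] := eqVneq i j; first by rewrite !same_deg_id.
by rewrite !same_deg_neq // linear0.
Qed.

Lemma tcx_map_comm i j (u : tcx_obj X M i) :
  tcx_map (tcx_d j u) = tcx_d j (tcx_map u).
Proof.
have comm i' j' (Y : bimodule A) (t : tensor Y (M i')) :
    tmap (bimod_id Y) (f j') (tmap (bimod_id Y) (cx_d M i' j') t)
    = tmap (bimod_id Y) (cx_d N i' j') (tmap (bimod_id Y) (f i') t).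
  move: t; apply: tensor_morph_ext => [s t|s t|x m]; rewrite ?tmapD //.
  by rewrite !tmap_pure /= cm_comm.
apply: injective_projections; rewrite /tcx_map /tcx_d /= ?comm //.
rewrite linearB /= comm; congr (_ - _); move: u.1.
apply: tensor_morph_ext => [s t|s t|x m]; rewrite ?tmapD //.
by rewrite !tmap_pure /= same_deg_map.
Qed.

Definition tensor_chain_map :
    chain_map (tensor_complex X M) (tensor_complex X N) :=
  @ChainMap A (tensor_complex X M) (tensor_complex X N)
    (fun i => @tcx_map i) tcx_map_comm.
End TensorComplexMap.

(* Categories whose sets of morphisms carry an equivalence relation [heq]
   playing the role of equality. *)
Record category := Category {
  obj :> Type;
  hom : obj -> obj -> Type;
  heq : forall X Y, hom X Y -> hom X Y -> Prop;
  idm : forall X, hom X X;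
  compm : forall X Y Z, hom Y Z -> hom X Y -> hom X Z;
  heq_refl : forall X Y (f : hom X Y), heq f f;
  heq_sym : forall X Y (f g : hom X Y), heq f g -> heq g f;
  heq_trans : forall X Y (f g h : hom X Y), heq f g -> heq g h -> heq f h;
  heq_comp : forall X Y Z (f f' : hom Y Z) (g g' : hom X Y),
    heq f f' -> heq g g' -> heq (compm f g) (compm f' g');
  comp_idl : forall X Y (f : hom X Y), heq (compm (idm Y) f) f;
  comp_idr : forall X Y (f : hom X Y), heq (compm f (idm X)) f;
  comp_assoc : forall X Y Z W (f : hom Z W) (g : hom Y Z) (h : hom X Y),
    heq (compm f (compm g h)) (compm (compm f g) h)
}.

Arguments hom {c} X Y.
Arguments heq {c X Y} f g.
Arguments idm {c} X.
Arguments compm {c X Y Z} f g.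

Record functor (C D : category) := Functor {
  fobj :> C -> D;
  fmap : forall X Y, hom X Y -> hom (fobj X) (fobj Y);
  fmap_heq : forall X Y (f g : hom X Y), heq f g -> heq (fmap f) (fmap g);
  fmap_id : forall X, heq (fmap (idm X)) (idm (fobj X));
  fmap_comp : forall X Y Z (f : hom Y Z) (g : hom X Y),
    heq (fmap (compm f g)) (compm (fmap f) (fmap g))
}.

Arguments fmap {C D} f {X Y} _ : rename.

Record nat_trans (C D : category) (F G : functor C D) := NatTrans {
  nt_map :> forall X : C, hom (F X) (G X);
  nt_natural : forall X Y (f : hom X Y),
    heq (compm (nt_map Y) (fmap F f)) (compm (fmap G f) (nt_map X))
}.

Definition is_iso (C : category) (X Y : C) (f : hom X Y) : Prop :=
  exists g : hom Y X, heq (compm g f) (idm X) /\ heq (compm f g) (idm Y).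

Definition nat_isomorphic (C D : category) (F G : functor C D) : Prop :=
  exists eta : nat_trans F G, forall X, is_iso (eta X).

Definition id_functor (C : category) : functor C C :=
  @Functor C C (fun X => X) (fun X Y f => f) (fun X Y f g fg => fg)
    (fun X => heq_refl (idm X)) (fun X Y Z f g => heq_refl (compm f g)).

Section CompFunctor.
Variables (C D E : category) (G : functor D E) (F : functor C D).

Lemma comp_fmap_id X : heq (fmap G (fmap F (idm X))) (idm (G (F X))).
Proof. exact: heq_trans (fmap_heq G (fmap_id F X)) (fmap_id G _). Qed.

Lemma comp_fmap_comp X Y Z (f : hom Y Z) (g : hom X Y) :
  heq (fmap G (fmap F (compm f g)))
      (compm (fmap G (fmap F f)) (fmap G (fmap F g))).
Proof. exact: heq_trans (fmap_heq G (fmap_comp F f g)) (fmap_comp G _ _). Qed.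

Definition comp_functor : functor C E :=
  @Functor C E (fun X => G (F X)) (fun X Y f => fmap G (fmap F f))
    (fun X Y f g fg => fmap_heq G (fmap_heq F fg)) comp_fmap_id comp_fmap_comp.
End CompFunctor.

(* F is invertible, up to natural isomorphism, for the composition of
   endofunctors, i.e. F is an auto-equivalence. *)
Definition invertible (C : category) (F : functor C C) : Prop :=
  exists G : functor C C,
    nat_isomorphic (comp_functor G F) (id_functor C) /\
    nat_isomorphic (comp_functor F G) (id_functor C).

(* The localization C[W^-1]: the category generated by the morphisms of C and
   formal inverses [Linv] of the morphisms in W. *)
Section Localization.
Variables (C : category) (W : forall X Y : C, hom X Y -> Prop).

Inductive loc_hom : C -> C -> Type :=
  | Lin X Y (f : hom X Y) : loc_hom X Y
  | Linv X Y (s : hom X Y) (Ws : W s) : loc_hom Y X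
  | Lcomp X Y Z (a : loc_hom Y Z) (b : loc_hom X Y) : loc_hom X Z.

Inductive loc_heq : forall X Y : C, loc_hom X Y -> loc_hom X Y -> Prop :=
  | loc_refl X Y (a : loc_hom X Y) : loc_heq a a
  | loc_sym X Y (a b : loc_hom X Y) : loc_heq a b -> loc_heq b a
  | loc_trans X Y (a b c : loc_hom X Y) :
      loc_heq a b -> loc_heq b c -> loc_heq a c
  | loc_comp X Y Z (a a' : loc_hom Y Z) (b b' : loc_hom X Y) :
      loc_heq a a' -> loc_heq b b' -> loc_heq (Lcomp a b) (Lcomp a' b')
  | loc_idl X Y (a : loc_hom X Y) : loc_heq (Lcomp (Lin (idm Y)) a) a
  | loc_idr X Y (a : loc_hom X Y) : loc_heq (Lcomp a (Lin (idm X))) a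
  | loc_assoc X Y Z T (a : loc_hom Z T) (b : loc_hom Y Z) (c : loc_hom X Y) :
      loc_heq (Lcomp a (Lcomp b c)) (Lcomp (Lcomp a b) c)
  | loc_in X Y (f g : hom X Y) : heq f g -> loc_heq (Lin f) (Lin g)
  | loc_in_comp X Y Z (f : hom Y Z) (g : hom X Y) :
      loc_heq (Lin (compm f g)) (Lcomp (Lin f) (Lin g))
  | loc_invl X Y (s : hom X Y) (Ws : W s) :
      loc_heq (Lcomp (Linv Ws) (Lin s)) (Lin (idm X))
  | loc_invr X Y (s : hom X Y) (Ws : W s) :
      loc_heq (Lcomp (Lin s) (Linv Ws)) (Lin (idm Y)).

Definition localization : category :=
  @Category C loc_hom loc_heq (fun X => Lin (idm X)) Lcomp
    loc_refl loc_sym loc_trans loc_comp loc_idl loc_idr loc_assoc.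

Definition loc_functor : functor C localization :=
  @Functor C localization (fun X => X) (fun X Y f => Lin f) loc_in
    (fun X => loc_refl (Lin (idm X))) loc_in_comp.
End Localization.

Section Derived.
Variable A : pzRingType.

Lemma cm_eq_trans (M N : complex A) (f g h : chain_map M N) :
  cm_eq f g -> cm_eq g h -> cm_eq f h.
Proof. by move=> fg gh i x; rewrite fg gh. Qed.

Lemma cm_eq_comp (M N P : complex A) (f f' : chain_map N P)
    (g g' : chain_map M N) :
  cm_eq f f' -> cm_eq g g' -> cm_eq (cm_comp f g) (cm_comp f' g').
Proof. by move=> ff gg i x /=; rewrite gg ff. Qed.

Definition Ch : category :=
  @Category (complex A) (@chain_map A) (@cm_eq A) (@cm_id A) (@cm_comp A)
    (fun M N f i x => erefl) (fun M N f g fg i x => esym (fg i x))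
    cm_eq_trans cm_eq_comp
    (fun M N f i x => erefl) (fun M N f i x => erefl)
    (fun M N P Q f g h i x => erefl).

Definition DerCat : category := @localization Ch (@quasi_iso A).

Definition to_DerCat : functor Ch DerCat := @loc_functor Ch (@quasi_iso A).

(* L is the total left derived functor of F: it comes with a natural map from
   L to F which is an isomorphism on the K-projective complexes, i.e. L(M) is
   computed by applying F to a K-projective resolution of M. *)
Definition is_left_derived (F : functor Ch Ch) (L : functor DerCat DerCat) :
    Prop :=
  exists eps : nat_trans (comp_functor L to_DerCat) (comp_functor to_DerCat F),
    forall P : complex A, K_projective P -> is_iso (eps P).

Variable X : two_term A.

Lemma tensor_chain_map_eq (M N : complex A) (f g : chain_map M N) :
  cm_eq f g -> cm_eq (tensor_chain_map X f) (tensor_chain_map X g).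
Proof.
move=> fg i u; apply: injective_projections => /=.
- move: u.1; apply: tensor_morph_ext => [s t|s t|x m]; rewrite ?tmapD //.
  by rewrite !tmap_pure fg.
- move: u.2; apply: tensor_morph_ext => [s t|s t|x m]; rewrite ?tmapD //.
  by rewrite !tmap_pure fg.
Qed.

Lemma tensor_chain_map_id (M : complex A) :
  cm_eq (tensor_chain_map X (cm_id M)) (cm_id (tensor_complex X M)).
Proof.
move=> i u; apply: injective_projections => /=.
- move: u.1; apply: tensor_morph_ext => [s t|s t|x m]; rewrite ?tmapD //.
  by rewrite !tmap_pure.
- move: u.2; apply: tensor_morph_ext => [s t|s t|x m]; rewrite ?tmapD //.
  by rewrite !tmap_pure.
Qed.

Lemma tensor_chain_map_comp (M N P : complex A) (f : chain_map N P)
    (g : chain_map M N) :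
  cm_eq (tensor_chain_map X (cm_comp f g))
        (cm_comp (tensor_chain_map X f) (tensor_chain_map X g)).
Proof.
move=> i u; apply: injective_projections => /=.
- by rewrite (@tmap_comp _ _ _ _ _ _ (bimod_id _) _ _ _ _ _ (cm_comp f g i)).
- by rewrite (@tmap_comp _ _ _ _ _ _ (bimod_id _) _ _ _ _ _ (cm_comp f g _)).
Qed.

Definition tensor_functor : functor Ch Ch :=
  @Functor Ch Ch (tensor_complex X) (@tensor_chain_map A X)
    tensor_chain_map_eq tensor_chain_map_id tensor_chain_map_comp.

Definition is_derived_tensor (L : functor DerCat DerCat) : Prop :=
  is_left_derived tensor_functor L.
End Derived.

(* The complex NH(1) -> F(1) of bimodules, in degrees 0 and 1. *)
Definition expF1 : two_term NH1 :=
  @TwoTerm NH1 (regular_bimodule NH1) F1 (@BimodHom _ _ _ mul_v1 mul_v1_ract).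

(* Main.v *)
Require Import Defs.
From mathcomp Require Import all_boot all_order all_algebra.
From HB Require Import structures.
From mathcomp Require Import boolp.
(* Imported again for [hom] to denote the morphisms of a [category]. *)
Import Defs.

Set Implicit Arguments.
Unset Strict Implicit.
Unset Printing Implicit Defensive.

Import GRing.Theory.
Local Open Scope ring_scope.

(** An invertible functor is faithful ([invertible_faithful]), and exp(-F(1))
    is not: it kills right multiplication by v_1, a nonzero map NH(1) -> NH(1).

    Write X for the complex NH(1) -> F(1), with differential t |-> t v_1.  The
    map that right multiplication by v_1 induces on X is null-homotopic, the
    homotopy being the inclusion of F(1) = NH(1) 1_1 in NH(1): in degree 0 this
    is the definition of the differential, and in degree 1 both F(1) v_1 and
    the right action of v_1 on F(1) vanish.  On tensor products the homotopy
    reads t (x) m |-> t (x) (m (.) 1_1), which is compatible with the right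
    action of NH(1) on F(1) ([tensor_rmul_v1_null_homotopic]).

    Null-homotopic maps vanish in the derived category, because they factor
    through the acyclic cone of an identity ([null_homotopic_DerCat]).  As a
    left derived functor agrees with the functor itself on K-projective
    complexes, the derived tensor product sends right multiplication by v_1 on
    a free module to zero.

    Before the functor is applied that map is not zero: its effect on cohomology
    ([DerCat_heq_cohomologous]) sends the class of 1 to that of v_1, and v_1 is
    nonzero because it acts as a matrix unit in a representation of NH(1) on
    Z^2 ([v1_neq0]).

    The free module is placed in all degrees at once, with zero differential
    ([graded_free]), so that no degree has to be singled out. *)

(** * Equivalences of categories *)

Section Cancellation.
Variable C : category.

Lemma is_iso_cancel_left (X Y Z : C) (e : hom Y Z) (f g : hom X Y) :
  is_iso e -> heq (compm e f) (compm e g) -> heq f g.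
Proof.
move=> [e' [e'e _]] efg.
have cancel (h : hom X Y) : heq (compm e' (compm e h)) h.
  apply: heq_trans (comp_assoc _ _ _) _.
  exact: heq_trans (heq_comp e'e (heq_refl h)) (comp_idl h).
apply: heq_trans (heq_sym (cancel f)) _.
exact: heq_trans (heq_comp (heq_refl e') efg) (cancel g).
Qed.

Lemma is_iso_cancel_right (X Y Z : C) (e : hom X Y) (f g : hom Y Z) :
  is_iso e -> heq (compm f e) (compm g e) -> heq f g.
Proof.
move=> [e' [_ ee']] fge.
have cancel (h : hom Y Z) : heq (compm (compm h e) e') h.
  apply: heq_trans (heq_sym (comp_assoc _ _ _)) _.
  exact: heq_trans (heq_comp (heq_refl h) ee') (comp_idr h).
apply: heq_trans (heq_sym (cancel f)) _.
exact: heq_trans (heq_comp fge (heq_refl e')) (cancel g).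
Qed.

Lemma invertible_faithful (F : functor C C) : invertible F ->
  forall (X Y : C) (f g : hom X Y),
    heq (fmap F f) (fmap F g) -> heq f g.
Proof.
move=> [G [[eta eta_iso] _]] X Y f g Ffg.
apply: (is_iso_cancel_right (eta_iso X)).
apply: heq_trans (heq_sym (nt_natural eta f)) _.
apply: heq_trans (nt_natural eta g).
exact: heq_comp (heq_refl _) (fmap_heq G Ffg).
Qed.
End Cancellation.

(** * Null-homotopic maps vanish in the derived category *)

Section ZeroInDerCat.
Variable A : pzRingType.
Implicit Types M N P : complex A.

Lemma cm_zero_comm M N i j (x : M i) :
  (\0 : M j -> N j) (cx_d M i j x) = cx_d N i j ((\0 : M i -> N i) x).
Proof. by rewrite /= linear0. Qed.

Definition cm_zero M N : chain_map M N :=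
  @ChainMap A M N (fun i => \0 : {linear M i -> N i}) (@cm_zero_comm M N).

Lemma acyclic_quasi_iso_zero M : acyclic M -> quasi_iso (cm_zero M M).
Proof.
move=> acM i; split=> [x cx _|y cy]; first exact: acM.
by exists y => //=; rewrite subr0; apply: acM.
Qed.

(** In the localization the zero endomorphism of an acyclic complex is
    invertible; being idempotent, it is the identity. *)
Lemma acyclic_id_zero M : acyclic M ->
  heq (fmap (to_DerCat A) (cm_id M)) (fmap (to_DerCat A) (cm_zero M M)).
Proof.
move=> /acyclic_quasi_iso_zero qz.
have z_iso : is_iso (fmap (to_DerCat A) (cm_zero M M)).
  by exists (Linv (C := Ch A) qz); split; [apply: loc_invl|apply: loc_invr].
apply: (is_iso_cancel_left z_iso).
apply: heq_trans (comp_idr _) _.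
by apply: heq_trans (fmap_comp _ _ _); apply: fmap_heq.
Qed.

Section ConeOfIdentity.
Variable M : complex A.

Definition cone_obj (i : int) : lmodType A := (M i * M (i + 1)%R)%type.

(** The differential is d (x, y) = (d x + y, - d y). *)
Definition cone_d i j (u : cone_obj i) : cone_obj j :=
  (cx_d M i j u.1 + same_deg M (i + 1) j u.2, - cx_d M (i + 1) (j + 1) u.2).

Lemma cone_d_linear i j : linear (@cone_d i j).
Proof.
move=> a u v; apply: injective_projections; rewrite /cone_d /= !linearP //=.
by rewrite scalerDr addrACA.
Qed.

HB.instance Definition _ i j := GRing.isLinear.Build A
  (cone_obj i) (cone_obj j) *:%R (@cone_d i j) (@cone_d_linear i j).

Lemma cone_d_shape i j (u : cone_obj i) : j != i + 1 -> cone_d j u = 0.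
Proof.
move=> ij; rewrite /cone_d !cx_d_shape ?(inj_eq (addIr 1)) //.
by rewrite same_deg_neq 1?eq_sym // addr0 oppr0.
Qed.

Lemma cone_dd i j k (u : cone_obj i) : cone_d k (cone_d j u) = 0.
Proof.
apply: injective_projections; rewrite /cone_d /= ?linearN /= ?cx_dd ?oppr0 //.
by rewrite linearD /= cx_dd add0r (@same_deg_d _ _ _ _ j) ?subrr.
Qed.

(** The cone of the identity of [M], indexed so that its component of degree [i]
    is the sum of those of [M] in degrees [i] and [i + 1]. *)
Definition cone_id : complex A :=
  @Complex A cone_obj (fun i j => @cone_d i j) cone_d_shape cone_dd.

Lemma cone_id_acyclic : acyclic cone_id.
Proof.
move=> i [x y]; rewrite /cocycle => -[].
rewrite /= same_deg_id => /addr0_eq <- _.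
have E : i - 1 + 1 = i by rewrite subrK.
(* The cocycle (x, - d x) of degree i is the differential of (0, x). *)
exists ((0, same_deg M i (i - 1 + 1) x) : cone_obj (i - 1)).
apply: injective_projections; rewrite /= /cone_d /= ?linear0 ?add0r.
  by rewrite E !same_deg_id.
by rewrite E same_deg_id.
Qed.

Definition cone_inj i (x : M i) : cone_id i := (x, 0).

Lemma cone_inj_linear i : linear (@cone_inj i).
Proof. by move=> a x y; congr (_, _); rewrite /= scaler0 addr0. Qed.

HB.instance Definition _ i := GRing.isLinear.Build A
  (M i) (cone_id i) *:%R (@cone_inj i) (@cone_inj_linear i).

Lemma cone_inj_comm i j (x : M i) :
  cone_inj (cx_d M i j x) = cx_d cone_id i j (cone_inj x).
Proof. by rewrite /= /cone_d /= !linear0 addr0. Qed.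

Definition cm_cone_inj : chain_map M cone_id :=
  @ChainMap A M cone_id (fun i => @cone_inj i) cone_inj_comm.

Variables (N : complex A) (f : chain_map M N).
Variable h : forall i j, {linear M i -> N j}.
Hypothesis hP : forall i (x : M i),
  f i x = cx_d N (i - 1) i (h i (i - 1) x) + h (i + 1) i (cx_d M i (i + 1) x).

Lemma homotopy_succ i (y : M (i + 1)) :
  f (i + 1) y = cx_d N i (i + 1) (h (i + 1) i y)
                + h (i + 1 + 1) (i + 1) (cx_d M (i + 1) (i + 1 + 1) y).
Proof. by rewrite hP addrK. Qed.

Definition cone_desc i (u : cone_id i) : N i := f i u.1 + h (i + 1) i u.2.

Lemma cone_desc_linear i : linear (@cone_desc i).
Proof.
by move=> a u v; rewrite /cone_desc /= !linearP /= scalerDr addrACA.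
Qed.

HB.instance Definition _ i := GRing.isLinear.Build A
  (cone_id i) (N i) *:%R (@cone_desc i) (@cone_desc_linear i).

Lemma cone_desc_comm i j (u : cone_id i) :
  cone_desc (cx_d cone_id i j u) = cx_d N i j (cone_desc u).
Proof.
have [->|ij] := eqVneq j (i + 1); last by rewrite !cx_d_shape // linear0.
rewrite /cone_desc /= /cone_d /= same_deg_id linearN !linearD /=.
by rewrite (homotopy_succ u.2) cm_comm addrA addrK.
Qed.

(** The extension of [f] to the cone of the identity given by a homotopy from
    [f] to zero. *)
Definition cm_cone_desc : chain_map cone_id N :=
  @ChainMap A cone_id N (fun i => @cone_desc i) cone_desc_comm.

Lemma cone_desc_inj : cm_eq (cm_comp cm_cone_desc cm_cone_inj) f.
Proof. by move=> i x; rewrite /= /cone_desc /= linear0 addr0. Qed.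
End ConeOfIdentity.

(** A null-homotopic map factors through the cone of the identity, and the
    identity of this acyclic complex is zero. *)
Lemma null_homotopic_DerCat M N (f : chain_map M N) : null_homotopic f ->
  heq (fmap (to_DerCat A) f) (fmap (to_DerCat A) (cm_zero M N)).
Proof.
move=> [h hP]; pose D := to_DerCat A.
pose p := cm_cone_inj M; pose q := cm_cone_desc hP.
have fE : heq (fmap D f) (compm (fmap D q) (fmap D p)).
  apply: heq_trans (fmap_comp D q p); apply: fmap_heq => i x.
  by rewrite -(cone_desc_inj hP).
have zE : heq (fmap D (cm_zero M N))
              (compm (fmap D q) (compm (fmap D (cm_zero _ _)) (fmap D p))).
  apply: heq_trans (heq_comp (heq_refl _) (fmap_comp D (cm_zero _ _) p)).
  apply: heq_trans (fmap_comp D _ _); apply: fmap_heq => i x.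
  by rewrite [RHS]linear0.
apply: heq_trans fE _; apply: heq_trans (heq_sym zE).
have pE : heq (fmap D p) (compm (fmap D (cm_zero _ _)) (fmap D p)).
  apply: heq_trans (heq_sym (comp_idl _)) _.
  have idE : heq (idm (D (cone_id M))) (fmap D (cm_zero _ _)).
    exact: acyclic_id_zero (@cone_id_acyclic M).
  exact: heq_comp idE (heq_refl _).
exact: heq_comp (heq_refl _) pE.
Qed.
End ZeroInDerCat.

(** * Cohomology on the derived category *)

Section Cohomology.
Variable A : pzRingType.
Implicit Types M N P : complex A.

Lemma coboundary_cocycle M i (x : M i) : coboundary x -> cocycle x.
Proof. by move=> [y <-]; apply: cx_dd. Qed.

Lemma coboundary0 M i : coboundary (0 : M i).
Proof. by exists 0; rewrite linear0. Qed.

Lemma coboundaryD M i (x y : M i) :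
  coboundary x -> coboundary y -> coboundary (x + y).
Proof. by move=> [x' <-] [y' <-]; exists (x' + y'); rewrite linearD. Qed.

Lemma coboundaryN M i (x : M i) : coboundary x -> coboundary (- x).
Proof. by move=> [x' <-]; exists (- x'); rewrite linearN. Qed.

Lemma coboundary_map M N (f : chain_map M N) i (x : M i) :
  coboundary x -> coboundary (f i x).
Proof. by move=> [x' <-]; exists (f (i - 1) x'); rewrite cm_comm. Qed.

Lemma cocycleD M i (x y : M i) : cocycle x -> cocycle y -> cocycle (x + y).
Proof. by rewrite /cocycle linearD => -> ->; rewrite addr0. Qed.

Lemma cocycle_map M N (f : chain_map M N) i (x : M i) :
  cocycle x -> cocycle (f i x).
Proof. by rewrite /cocycle -cm_comm => ->; rewrite linear0. Qed.

(** The elements [x] and [y] are cocycles with the same cohomology class. *)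
Definition cohomologous M i (x y : M i) : Prop :=
  [/\ cocycle x, cocycle y & coboundary (y - x)].

Lemma cohomologous_refl M i (x : M i) : cocycle x -> cohomologous x x.
Proof. by move=> cx; split=> //; rewrite subrr; apply: coboundary0. Qed.

Lemma cohomologous_sym M i (x y : M i) : cohomologous x y -> cohomologous y x.
Proof. by move=> [cx cy /coboundaryN b]; split=> //; rewrite -opprB. Qed.

Lemma cohomologous_trans M i (x y z : M i) :
  cohomologous x y -> cohomologous y z -> cohomologous x z.
Proof.
move=> [cx _ bxy] [_ cz byz]; split=> //.
by rewrite -(subrK y z) -addrA; apply: coboundaryD.
Qed.

Lemma cohomologous_map M N (f : chain_map M N) i (x y : M i) :
  cohomologous x y -> cohomologous (f i x) (f i y).
Proof.
move=> [cx cy bxy]; split; try exact: cocycle_map.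
by rewrite -linearB; apply: coboundary_map.
Qed.

(** The graph, on cocycles of degree [i], of the map induced on cohomology by a
    morphism of the derived category; a formal inverse is sent to the converse
    relation.  Relations make it unnecessary to form the quotients of cocycles
    by coboundaries. *)
Fixpoint coh_graph (i : int) (M N : Ch A)
    (a : @loc_hom (Ch A) (@quasi_iso A) M N) : M i -> N i -> Prop :=
  match a in loc_hom _ M N return (M : complex A) i -> (N : complex A) i -> Prop
  with
  | Lin M N f => fun x y =>
      cocycle x /\ cohomologous ((f : chain_map M N) i x) y
  | Linv M N s _ => fun y x =>
      cocycle x /\ cohomologous ((s : chain_map M N) i x) y
  | Lcomp M N P a b => fun x z =>
      exists2 y, coh_graph b x y & coh_graph a y z
  end.

Lemma coh_graph_cocycle i (M N : Ch A) (a : @loc_hom (Ch A) (@quasi_iso A) M N)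
    (x : (M : complex A) i) (y : (N : complex A) i) :
  coh_graph a x y -> cocycle x /\ cocycle y.
Proof.
elim: a x y => {M N} [M N f|M N s qs|M N P a IHa b IHb] x y /=.
- by move=> [cx []].
- by move=> [cy []].
- by move=> [z /IHb[cx _] /IHa[_ cy]].
Qed.

(** The relation only depends on cohomology classes. *)
Lemma coh_graph_cohomologous i (M N : Ch A)
    (a : @loc_hom (Ch A) (@quasi_iso A) M N)
    (x x' : (M : complex A) i) (y y' : (N : complex A) i) :
  coh_graph a x y -> cohomologous x x' -> cohomologous y y' ->
  coh_graph a x' y'.
Proof.
elim: a x x' y y' => {M N} [M N f|M N s qs|M N P a IHa b IHb] x x' y y' /=.
- move=> [cx fxy] xx' yy'; split; first by case: xx'.
  apply: cohomologous_trans (cohomologous_trans fxy yy').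
  exact/cohomologous_map/cohomologous_sym.
- move=> [cx fxy] xx' yy'; split; first by case: yy'.
  apply: cohomologous_trans (cohomologous_trans fxy xx').
  exact/cohomologous_map/cohomologous_sym.
- move=> [z xz zy] xx' yy'; exists z.
  + apply: (IHb _ _ _ _ xz xx'); apply: cohomologous_refl.
    by case: (coh_graph_cocycle zy).
  + apply: (IHa _ _ _ _ zy _ yy'); apply: cohomologous_refl.
    by case: (coh_graph_cocycle xz).
Qed.

Lemma quasi_iso_cohomologous M N (s : chain_map M N) i (x x' : M i) :
  quasi_iso s -> cocycle x -> cocycle x' ->
  cohomologous (s i x) (s i x') -> cohomologous x x'.
Proof.
move=> /(_ i)[s_inj _] cx cx' [_ _]; rewrite -linearB => bs.
have cN : cocycle (- x) by rewrite /cocycle linearN cx oppr0.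
by split=> //; apply: s_inj bs; apply: cocycleD.
Qed.

(** The relation is the same for equal morphisms of the derived category; the
    two inversion rules for a quasi-isomorphism [s] hold by the injectivity and
    the surjectivity of [s] on cohomology. *)
Lemma coh_graph_heq i (M N : Ch A) (a b : @loc_hom (Ch A) (@quasi_iso A) M N) :
  loc_heq a b -> forall (x : (M : complex A) i) (y : (N : complex A) i),
  coh_graph a x y <-> coh_graph b x y.
Proof.
elim=> {M N a b}.
- by [].
- by move=> M N a b _ IH x y; rewrite IH.
- by move=> M N a b c _ IHab _ IHbc x y; rewrite IHab IHbc.
- move=> M N P a a' b b' _ IHa _ IHb x y /=.
  by split=> -[z xz zy]; exists z; by [apply/IHb|apply/IHa].
- move=> M N a x y /=; split=> [[z xz [cz zy]]|xy].
    apply: (coh_graph_cohomologous xz _ zy); apply: cohomologous_refl.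
    by case: (coh_graph_cocycle xz).
  have [cx cy] := coh_graph_cocycle xy.
  by exists y => //; split=> //; apply: cohomologous_refl.
- move=> M N a x y /=; split=> [[z [cx xz] zy]|xy].
    apply: (coh_graph_cohomologous zy (cohomologous_sym xz)).
    by apply: cohomologous_refl; case: (coh_graph_cocycle zy).
  have [cx cy] := coh_graph_cocycle xy.
  by exists x => //; split=> //; apply: cohomologous_refl.
- move=> M N P Q a b c x y /=; split.
    by move=> [z [w xw wz] zy]; exists w => //; exists z.
  by move=> [z xz [w zw wy]]; exists w => //; exists z.
- by move=> M N f g fg x y /=; rewrite fg.
- move=> M N P f g x y /=; split=> [[cx fgxy]|[z [cx gxz] [cz fzy]]].
    have cgx : cocycle ((g : chain_map _ _) i x) by apply: cocycle_map.
    by exists ((g : chain_map _ _) i x); split=> //; apply: cohomologous_refl.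
  split=> //; apply: cohomologous_trans fzy.
  exact: (cohomologous_map f).
- move=> M N s qs x y /=; split=> [[z [cx sxz] [cy syz]]|[cx xy]].
    split=> //; apply: (quasi_iso_cohomologous qs) => //.
    exact: cohomologous_trans sxz (cohomologous_sym syz).
  have csx : cocycle ((s : chain_map _ _) i x) by apply: cocycle_map.
  exists ((s : chain_map _ _) i x); split=> //.
    exact: cohomologous_refl.
  by case: (xy).
  by apply/(cohomologous_map s)/cohomologous_sym.
- move=> M N s qs x y /=; split=> [[z [cz szx] [_ szy]]|[cx xy]].
    split; first by case: szx.
    exact: cohomologous_trans (cohomologous_sym szx) szy.
  have [_ /(_ x cx)[z cz bz]] := qs i.
  have szx : cohomologous ((s : chain_map _ _) i z) x.
    by split=> //; apply: cocycle_map.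
  by exists z; split=> //; apply: cohomologous_trans szx xy.
Qed.

(** Chain maps which agree in the derived category agree on cohomology. *)
Lemma DerCat_heq_cohomologous M N (f g : chain_map M N) :
  heq (fmap (to_DerCat A) f) (fmap (to_DerCat A) g) ->
  forall i (x : M i), cocycle x -> cohomologous (g i x) (f i x).
Proof.
move=> fg i x cx.
have fx : coh_graph (@Lin (Ch A) (@quasi_iso A) _ _ f) x (f i x).
  by split=> //; apply/cohomologous_refl/cocycle_map.
by have [] := proj1 (coh_graph_heq fg x (f i x)) fx.
Qed.
End Cohomology.

(** * Graded free modules *)

Section GradedFree.
Variable A : pzRingType.

Lemma graded_free_shape (i j : int) (x : A^o) :
  j != i + 1 -> (\0 : A^o -> A^o) x = 0.
Proof. by []. Qed.

Lemma graded_free_dd (i j k : int) (x : A^o) :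
  (\0 : A^o -> A^o) ((\0 : A^o -> A^o) x) = 0.
Proof. by []. Qed.

(** The free module [A] in every degree, with zero differential: the sum of all
    the shifts of [A]. *)
Definition graded_free : complex A :=
  @Complex A (fun _ => A^o) (fun _ _ => \0 : {linear A^o -> A^o})
    graded_free_shape graded_free_dd.

Section Scale.
Variables (M : lmodType A) (m : M).

(** The linear map from [A] to [M] which sends 1 to [m]. *)
Definition scale_at (a : A^o) : M := (a : A) *: m.

Lemma scale_at_linear : linear scale_at.
Proof.
by move=> a x y; rewrite /scale_at scalerDl -[a *: x]/(a * x) scalerA.
Qed.

HB.instance Definition _ :=
  GRing.isLinear.Build A A^o M *:%R scale_at scale_at_linear.
End Scale.

Lemma graded_free_K_projective : K_projective graded_free.
Proof.
move=> N acN f.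
have y_ex (i : int) : exists y : N (i - 1), cx_d N (i - 1) i y = f i 1.
  apply: (acN i (f i 1)); rewrite /cocycle -cm_comm.
  exact: linear0.
pose y i := sval (cid (y_ex i)).
have yP i : cx_d N (i - 1) i (y i) = f i 1 := svalP (cid (y_ex i)).
(* The differential of N sends y i to f i 1, so 1 |-> y i is a homotopy. *)
exists (fun i j => scale_at (same_deg N (i - 1) j (y i)) : {linear A^o -> N j}).
move=> i x; rewrite linear0 addr0 /= /scale_at same_deg_id linearZ /= yP.
by rewrite -linearZ /=; congr (f i _); rewrite -[RHS]/(x * 1) mulr1.
Qed.

Section RightMultiplication.
Variable c : A.

(** Right multiplication by [c], a map of left modules. *)
Definition rmul (x : A^o) : A^o := x * c.

Lemma rmul_linear : linear rmul.
Proof. by move=> a x y; rewrite /rmul mulrDl -[a *: x]/(a * x) -mulrA. Qed.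

HB.instance Definition _ :=
  GRing.isLinear.Build A A^o A^o *:%R rmul rmul_linear.

Lemma rmul_comm (i j : int) (x : A^o) :
  rmul ((\0 : A^o -> A^o) x) = \0 (rmul x).
Proof. by rewrite /= linear0. Qed.

Definition cm_rmul : chain_map graded_free graded_free :=
  @ChainMap A graded_free graded_free (fun _ => rmul : {linear A^o -> A^o})
    rmul_comm.
End RightMultiplication.

(** Multiplication by [c] sends the cohomology class of 1 to that of [c]. *)
Lemma cm_rmul_eq0 (c : A) :
  heq (fmap (to_DerCat A) (cm_rmul c))
      (fmap (to_DerCat A) (cm_zero graded_free graded_free)) ->
  c = 0.
Proof.
move=> /DerCat_heq_cohomologous/(_ 0 1 erefl)[_ _ [y]] /=.
by rewrite subr0 /rmul mul1r => <-.
Qed.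

Lemma same_deg_const (i j : int) (x : A^o) :
  i = j -> same_deg graded_free i j x = x.
Proof.
by rewrite /same_deg => ij; case: eqP => // e; case: j / e {ij}.
Qed.
End GradedFree.

(** * Tensoring with zero maps *)

Lemma tmap_zero (A : pzRingType) (X Y : bimodule A) (M N : lmodType A)
    (f : bimod_hom X Y) (g : {linear M -> N}) (t : tensor X M) :
  g =1 \0 -> tmap f g t = 0.
Proof.
have tpure0 x : tpure x 0 = 0 :> tensor Y N.
  by apply: (addrI (tpure x 0)); rewrite -tpureDr !addr0.
move=> g0; apply: (tensor_morph_ext (g := fun=> 0)) t => [s t|s t|x m].
- exact: tmapD.
- by rewrite addr0.
- by rewrite tmap_pure g0.
Qed.

Lemma tensor_chain_map_zero (A : pzRingType) (X : two_term A)
    (M N : complex A) :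
  cm_eq (tensor_chain_map X (cm_zero M N))
        (cm_zero (tensor_complex X M) (tensor_complex X N)).
Proof. by move=> i u; apply: injective_projections; apply: tmap_zero. Qed.

(** * The effect of exp(-F(1)) on right multiplication by v_1 *)

Lemma f1_val_v1 (t : F1) : f1_val t * v1 = 0.
Proof. by rewrite -f1_valP -mulrA one1_v1 mulr0. Qed.

(** The pairing (t, m) |-> t (x) (m (.) 1_1) of F(1) and NH(1) with values in
    NH(1) (x) NH(1). *)
Definition htpy_pure (t : F1) (m : NH1^o) :
    tensor (regular_bimodule NH1) NH1^o :=
  @tpure _ (regular_bimodule NH1) NH1^o (f1_val t) (nh1_shift m).

Lemma htpy_pureP :
  [/\ forall m, {morph htpy_pure^~ m : s t / s + t},
      forall t, {morph htpy_pure t : m n / m + n} &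
      forall t a m, htpy_pure (ract t a) m = htpy_pure t (a *: m)].
Proof.
rewrite /htpy_pure; split=> [m s t|t m n|t a m]; first exact: tpureDl.
  by rewrite nh1_shiftD tpureDr.
rewrite -[a *: m]/(a * m) nh1_shiftM.
rewrite -[nh1_shift a * _]/(nh1_shift a *: (nh1_shift m : NH1^o)).
by rewrite -tpure_ract.
Qed.

(** The homotopy, from F(1) (x) NH(1) to NH(1) (x) NH(1). *)
Definition htpy : tensor F1 NH1^o -> tensor (regular_bimodule NH1) NH1^o :=
  tlift htpy_pure.

Lemma htpyE t m : htpy (tpure t m) = htpy_pure t m.
Proof. by have [Dl Dr E] := htpy_pureP; apply: tlift_pure. Qed.

Lemma htpyD : {morph htpy : s t / s + t}.
Proof. by have [Dl Dr E] := htpy_pureP; apply: tliftD. Qed.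

Lemma htpy_linear : linear htpy.
Proof.
move=> a s t; rewrite htpyD; congr (_ + _); move: s.
apply: tensor_morph_ext => [s s'|s s'|x m]; rewrite ?scalerDr ?htpyD //.
  by rewrite scalerDr.
by rewrite tpureZ !htpyE /htpy_pure tpureZ.
Qed.

HB.instance Definition _ := GRing.isLinear.Build NH1
  (tensor F1 NH1^o) (tensor (regular_bimodule NH1) NH1^o) *:%R htpy htpy_linear.

(** In degree 0, as a v_1 (x) (m (.) 1_1) = a (x) v_1 (m (.) 1_1), which is
    a (x) m v_1. *)
Lemma htpy_d (g : {linear NH1^o -> NH1^o})
    (t : tensor (regular_bimodule NH1) NH1^o) :
  g =1 id -> htpy (tmap (tt_d expF1) g t)
  = tmap (bimod_id (regular_bimodule NH1)) (rmul v1) t.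
Proof.
move=> gE; move: t.
apply: tensor_morph_ext => [s t|s t|x m]; rewrite ?tmapD ?htpyD //.
rewrite !tmap_pure htpyE gE /htpy_pure /= /rmul (v1_shift m).
by rewrite -[v1 * _]/(v1 *: (nh1_shift m : NH1^o)) -tpure_ract.
Qed.

(** In degree 1 both sides are zero: t v_1 = 0 for t in F(1), and the right
    action of v_1 on F(1) is zero. *)
Lemma d_htpy (g : {linear NH1^o -> NH1^o}) (t : tensor F1 NH1^o) :
  g =1 id -> tmap (tt_d expF1) g (htpy t) = tmap (bimod_id F1) (rmul v1) t.
Proof.
move=> gE; move: t.
apply: tensor_morph_ext => [s t|s t|x m]; rewrite ?tmapD ?htpyD ?tmapD //.
rewrite htpyE !tmap_pure gE /= /rmul.
have -> : mul_v1 (f1_val x) = 0 by apply: val_inj; rewrite /= f1_val_v1.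
rewrite (v1_shift m) -[v1 * _]/(v1 *: (nh1_shift m : NH1^o)) -tpure_ract.
by rewrite [ract _ _]F1_ract_v1.
Qed.

(** The homotopy on the tensor product with [graded_free]; its components are
    the same for all the degrees [i] and [j]. *)
Definition tcx_htpy (i j : int) (u : tcx_obj expF1 (graded_free NH1) i) :
    tcx_obj expF1 (graded_free NH1) j :=
  (htpy u.2, 0).

Lemma tcx_htpy_linear i j : linear (@tcx_htpy i j).
Proof.
move=> a u v; apply: injective_projections; rewrite /tcx_htpy /= ?linearP //.
by rewrite scaler0 addr0.
Qed.

HB.instance Definition _ i j := GRing.isLinear.Build NH1
  (tcx_obj expF1 (graded_free NH1) i) (tcx_obj expF1 (graded_free NH1) j) *:%R
  (@tcx_htpy i j) (@tcx_htpy_linear i j).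

Lemma tensor_rmul_v1_null_homotopic :
  null_homotopic (tensor_chain_map expF1 (cm_rmul v1)).
Proof.
exists (fun i j => @tcx_htpy i j) => i [s t].
apply: injective_projections; rewrite /= /tcx_d /tcx_htpy /=.
  rewrite [X in _ = X + _]tmap_zero // add0r [X in _ - X]tmap_zero // subr0.
  by rewrite htpy_d // => x; rewrite /= same_deg_const // addrK.
rewrite linear0 subr0 addr0 d_htpy // => x.
by rewrite /= same_deg_const.
Qed.

(** * A representation of NH(1) *)

(** The representation of NH(1) on Z^2 in which 1_0, 1_1 and v_1 act by the
    matrix units in positions (0, 0), (1, 1) and (0, 1), and the other
    generators by zero. *)
Fixpoint mx_term (t : nh_term) : 'M[int]_2 :=
  match t with
  | Gen (Idem 0) => delta_mx ord0 ord0
  | Gen (Idem 1) => delta_mx ord_max ord_max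
  | Gen (Vee 1 1) => delta_mx ord0 ord_max
  | Gen _ => 0
  | NZero => 0
  | NOpp s => - mx_term s
  | NAdd s t => mx_term s + mx_term t
  | NMul s t => mx_term s *m mx_term t
  end.

Lemma mx_term_rel s t : nh_rel s t -> mx_term s = mx_term t.
Proof.
have Ed i j k : delta_mx i j *m delta_mx j k = delta_mx i k :> 'M[int]_2.
  exact: mul_delta_mx.
have E := (mul0mx, mulmx0, Ed, subrr, addr0, oppr0).
have E' i j k l : j != k -> delta_mx i j *m delta_mx k l = 0 :> 'M[int]_2.
  exact: mul_delta_mx_0.
case=> {s t} /=.
- case=> [n|i n|i n|[|[|i]] [|[|n]]] //=.
- by move=> [|[|n]]; rewrite /= ?E.
- by move=> [|[|n]] [|[|m]] nm; rewrite /= ?E ?E'.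
all: try by move=> *; rewrite /= ?E.
- by move=> [|[|i]] [|[|n]] //; rewrite /= ?E.
- by move=> [|[|i]] [|[|n]] //; rewrite /= ?E.
- by move=> [|i] [|[|n]] //; rewrite /= ?E.
- by move=> [|i] [|[|n]] //; rewrite /= ?E.
- by move=> [|[|i]] [|[|j]] [|[|n]] //; rewrite /= ?E.
Qed.

Lemma mx_term_cong s t : nh_cong nh1_rel s t -> mx_term s = mx_term t.
Proof.
elim=> {s t} /=.
- by move=> _ _ [s t|n n0] //; apply: mx_term_rel.
- by [].
- by move=> s t _ ->.
- by move=> s t u _ -> _.
- by move=> s s' _ ->.
- by move=> s s' t t' _ -> _ ->.
- by move=> s s' t t' _ -> _ ->.
- by move=> s t u; rewrite addrA.
- by move=> s t; rewrite addrC.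
- by move=> s; rewrite add0r.
- by move=> s; rewrite addNr.
- by move=> s t u; rewrite mulmxA.
- by move=> s t u; rewrite mulmxDl.
- by move=> s t u; rewrite mulmxDr.
Qed.

Lemma v1_neq0 : v1 <> 0.
Proof.
move/nh1_eqP/mx_term_cong => /= /(congr1 (fun M : 'M_2 => M ord0 ord_max)).
by rewrite !mxE !eqxx.
Qed.

Theorem mainTheorem4 (L : functor (DerCat NH1) (DerCat NH1))
    (L_derived : is_derived_tensor expF1 L) :
  ~ invertible L.
Proof.
move=> /invertible_faithful L_faithful; have [eps eps_iso] := L_derived.
pose K : Ch NH1 := graded_free NH1.
pose f : Defs.hom K K := cm_rmul v1; pose z : Defs.hom K K := cm_zero K K.
apply: v1_neq0; apply: cm_rmul_eq0; apply: L_faithful.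
(* At K, which is K-projective, eps identifies L with the tensor product. *)
apply: (is_iso_cancel_left (eps_iso K (@graded_free_K_projective _))).
apply: heq_trans (nt_natural eps f) _.
apply: heq_trans (heq_sym (nt_natural eps z)).
apply: heq_comp (heq_refl _).
apply: heq_trans (null_homotopic_DerCat tensor_rmul_v1_null_homotopic) _.
apply: heq_sym; apply: (fmap_heq (to_DerCat NH1)).
exact: tensor_chain_map_zero.
Qed.
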